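(* Suppose that $g,h\in\mathcal{M}$ and let $F(z)=\dfrac{g(z)h(z)}{z}$ for $z\in\mathbb{D}$. Then $F$ belongs to $\mathcal{M}$ in the disk $|z|\leq r_0$, where $r_0$ ($\approx 0.294876$) is the smallest root in $(0,1)$ of the equation $9r^4+16r^3+6r^2-1=0$. The result is sharp, i.e. $r_0$ cannot be replaced by any larger number: for every $r\in(r_0,1)$ there are $g,h\in\mathcal{M}$ such that $F$ does not belong to $\mathcal{M}$ in the disk $|z|\le r$.
   Context: $\mathbb{D}=\{z\in\mathbb{C}:|z|<1\}$. $\mathcal{A}$ is the family of functions $f$ analytic in $\mathbb{D}$ with $f(0)=0$ and $f'(0)=1$. $\mathcal{M}$ is the class of $f\in\mathcal{A}$ (with $f(z)\neq 0$ for $z\in\mathbb{D}\setminus\{0\}$, so that $z/f(z)$ is analytic in $\mathbb{D}$ with value $1$ at $0$) such that $$\left|z^2\left(\frac{z}{f(z)}\right)''+f'(z)\left(\frac{z}{f(z)}\right)^2-1\right|\leq 1\quad\text{for all } z\in\mathbb{D}.$$ For $0<r<1$, a function $F$ ''belongs to $\mathcal{M}$ in the disk $|z|\le r$'' if $F$ is analytic there with $F(0)=0$, $F'(0)=1$, $F(z)\ne0$ for $0<|z|\le r$, and the inequality $$\left|z^2\left(\frac{z}{F(z)}\right)''+F'(z)\left(\frac{z}{F(z)}\right)^2-1\right|\leq 1$$ holds for all $|z|\le r$. Removable singularities at $0$ are removed. *)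

(* Defs.v *)
From Stdlib Require Import Reals.
From Coquelicot Require Import Coquelicot.
Open Scope R_scope.

Definition unit_disk (z : C) : Prop := Cmod z < 1.

Definition closed_disk (r : R) (z : C) : Prop := Cmod z <= r.

(** Functions are total on [C]; only their values near [S] matter. Analytic at a
    point means complex differentiable on a neighbourhood of it, so for
    [closed_disk r] analyticity extends slightly past the boundary. *)
Definition analytic_on (S : C -> Prop) (f : C -> C) : Prop :=
  forall z : C, S z ->
    locally z (fun w : C => ex_derive (K := C_AbsRing) (V := C_NormedModule) f w).

(** [z / f z], the singularity at 0 being removed using [f 0 = 0], [f' 0 = 1]. *)
Definition z_over (f : C -> C) (z : C) : C :=
  if Ceq_dec z 0 then RtoC 1 else (z / f z)%C.

Definition M_expr (f : C -> C) (z : C) : C :=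
  (z ^ 2 * C_derive (C_derive (z_over f)) z
   + C_derive f z * z_over f z ^ 2 - 1)%C.

(** [C_derive] is total, but under the first four conditions (with [S] a disk
    around 0) [f] and [z_over f] are analytic on [S], so every derivative
    occurring in [M_expr] is a genuine complex derivative. *)
Definition in_M_on (S : C -> Prop) (f : C -> C) : Prop :=
  analytic_on S f /\
  f 0 = 0 /\
  C_derive f 0 = 1 /\
  (forall z : C, S z -> z <> 0 -> f z <> 0) /\
  (forall z : C, S z -> Cmod (M_expr f z) <= 1).

Definition class_M (f : C -> C) : Prop := in_M_on unit_disk f.

(** [g z * h z / z], whose removable singularity at 0 has value 0. *)
Definition prod_over_z (g h : C -> C) (z : C) : C :=
  if Ceq_dec z 0 then RtoC 0 else (g z * h z / z)%C.

Definition root_in_01 (r : R) : Prop :=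
  0 < r < 1 /\ 9 * r ^ 4 + 16 * r ^ 3 + 6 * r ^ 2 - 1 = 0.

Definition smallest_root_in_01 (r : R) : Prop :=
  root_in_01 r /\ forall s : R, root_in_01 s -> r <= s.

(* Main.v *)
(** With [u z = z / f z] one has [M_expr f = z^2 u'' - z u' + u - 1]. Goursat's theorem and
    Cauchy's formula show that derivatives and difference quotients of holomorphic functions are
    holomorphic, so [u z = 1 + z (b + v z)] with [v] holomorphic, [v 0 = 0], and then
    [M_expr f = z^2 (v' + z v'')]. The maximum principle gives [|v' + z v''| <= 1]; as this is the
    derivative of [z v'], integrating twice gives [|v'| <= 1] and [|v| <= |z|]. Since [u] has
    no zero in the disk, [|b| <= 2]. For a product of two such functions [u] the triangle inequality
    yields [|M_expr| <= 6 r^2 + 16 r^3 + 9 r^4], with equality at [z = r] for the Koebe function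
    [z / (1 + z)^2]. *)

Require Import Defs.
From Stdlib Require Import Reals Lra Lia.
From Coquelicot Require Import Coquelicot.
Open Scope R_scope.

(** * Complex derivatives *)

(** On a power series the operator [z^2 u'' - z u' + u] multiplies the n-th term by (n - 1)^2. It
    therefore kills the linear term: the defining inequality controls [v] through the weights (n -
    1)^2, but says nothing about [b]. The only information on [b] is that [f] is finite, i.e. that
    [u] has no zero in the disk.

    Class membership provides no more than complex differentiability near each point, so even the
    existence of [u''] has to be earned. Expansions are replaced by difference quotients, and every
    contour integral is an integral over a real parameter on a circle about 0, also for points [z]
    off the centre.

    In the product the three coefficients are worst-case counts with [|b|, |c| <= 2]: 4 + 2 for
    [r^2], 2 * (2 * 4) for [r^3], 8 + 1 for [r^4]. All of them are attained together because the
    Koebe function has [u = (1 + z)^2], i.e. [b = 2] and [v z = z], with positive coefficients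
    throughout. *)

Lemma locally_Cmod (z : C) (P : C -> Prop) :
  locally z P <-> exists d, 0 < d /\ forall w : C, Cmod (w - z) < d -> P w.
Proof.
  split.
  - intros H. destruct (locally_norm_le_locally (V := C_NormedModule) z P H) as [d Hd].
    exists d. split; [apply cond_pos|exact Hd].
  - intros (d & Hd & H). apply (locally_le_locally_norm (V := C_NormedModule) z P).
    exists (mkposreal d Hd). exact H.
Qed.

(** Stated with [Cmod] alone, so that it does not depend on which of the two uniform structures,
    product or modulus, is put on [C]. *)
Definition cderiv (f : C -> C) (z l : C) : Prop :=
  forall eps, 0 < eps -> exists d, 0 < d /\
    forall w : C, Cmod (w - z) < d ->
      Cmod (f w - f z - l * (w - z)) <= eps * Cmod (w - z).

Lemma cderiv_is_derive (f : C -> C) (z l : C) :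
  cderiv f z l <-> is_derive (K := C_AbsRing) (V := C_NormedModule) f z l.
Proof.
  split.
  - intros H. split; [apply is_linear_scal_l|].
    intros x Hx eps.
    rewrite <- (is_filter_lim_locally_unique (V := AbsRing_NormedModule C_AbsRing) z x Hx).
    destruct (H eps (cond_pos eps)) as (d & Hd & Hw).
    apply locally_C, locally_Cmod. exists d. split; [exact Hd|].
    intros w Hwd. specialize (Hw w Hwd).
    replace (norm _) with (Cmod (f w - f z - l * (w - z))); [exact Hw|].
    change (Cmod (f w - f z - l * (w - z)) = Cmod (f w - f z - (w - z) * l)).
    f_equal. ring.
  - intros [_ H] eps Heps.
    specialize (H z (fun P HP => HP) (mkposreal eps Heps)).
    apply locally_C, locally_Cmod in H. destruct H as (d & Hd & H).
    exists d. split; [exact Hd|]. intros w Hw. specialize (H w Hw).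
    replace (f w - f z - l * (w - z))%C with (f w - f z - (w - z) * l)%C by ring.
    exact H.
Qed.

(** Only the normed module on the target changes, and both carry the same norm, so the remainder
    condition carries over as it stands. The product and composition rules are applied in this
    second structure. *)
Lemma cderiv_is_derive_AbsRing (f : C -> C) (z l : C) :
  cderiv f z l <-> is_derive (K := C_AbsRing) (V := AbsRing_NormedModule C_AbsRing) f z l.
Proof.
  rewrite cderiv_is_derive. split; intros [_ H]; (split; [apply is_linear_scal_l|exact H]).
Qed.

Lemma cderiv_unique (f : C -> C) (z l : C) : cderiv f z l -> C_derive f z = l.
Proof. intros H. apply is_C_derive_unique, cderiv_is_derive, H. Qed.

Lemma cderiv_ex (f : C -> C) (z : C) :
  (exists l, cderiv f z l) <-> ex_derive (K := C_AbsRing) (V := C_NormedModule) f z.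
Proof.
  split; intros [l H]; exists l; apply cderiv_is_derive, H.
Qed.

Lemma cderiv_C_derive (f : C -> C) (z l : C) : cderiv f z l -> cderiv f z (C_derive f z).
Proof. intros H. rewrite (cderiv_unique _ _ _ H). exact H. Qed.

(** Lets a derivative be computed from a formula that represents the function only near [z], such as
    a Cauchy integral over a fixed circle. *)
Lemma cderiv_ext_ball (f g : C -> C) (z l : C) (d : R) :
  0 < d -> (forall w : C, Cmod (w - z) < d -> f w = g w) ->
  cderiv f z l -> cderiv g z l.
Proof.
  intros Hd Hfg Hf eps Heps. destruct (Hf eps Heps) as (d' & Hd' & H).
  exists (Rmin d d'). split; [apply Rmin_glb_lt; assumption|].
  intros w Hw. rewrite <- (Hfg w), <- (Hfg z).
  - apply H. eapply Rlt_le_trans; [exact Hw|apply Rmin_r].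
  - replace (z - z)%C with (RtoC 0) by ring. now rewrite Cmod_0.
  - eapply Rlt_le_trans; [exact Hw|apply Rmin_l].
Qed.

Lemma cderiv_eq (f : C -> C) (z l : C) l' : cderiv f z l -> l = l' -> cderiv f z l'.
Proof. now intros H <-. Qed.

Lemma cderiv_const (c z : C) : cderiv (fun _ => c) z 0.
Proof. apply cderiv_is_derive_AbsRing. apply (is_derive_const (V := AbsRing_NormedModule C_AbsRing)). Qed.

Lemma cderiv_id (z : C) : cderiv (fun w => w) z 1.
Proof. apply cderiv_is_derive_AbsRing. apply (is_derive_id (K := C_AbsRing)). Qed.

Lemma cderiv_plus (f g : C -> C) (z l m : C) :
  cderiv f z l -> cderiv g z m -> cderiv (fun w => f w + g w)%C z (l + m)%C.
Proof.
  rewrite !cderiv_is_derive_AbsRing.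
  apply (is_derive_plus (V := AbsRing_NormedModule C_AbsRing)).
Qed.

Lemma cderiv_minus (f g : C -> C) (z l m : C) :
  cderiv f z l -> cderiv g z m -> cderiv (fun w => f w - g w)%C z (l - m)%C.
Proof.
  rewrite !cderiv_is_derive_AbsRing.
  apply (is_derive_minus (V := AbsRing_NormedModule C_AbsRing)).
Qed.

Lemma cderiv_mult (f g : C -> C) (z l m : C) :
  cderiv f z l -> cderiv g z m -> cderiv (fun w => f w * g w)%C z (l * g z + f z * m)%C.
Proof.
  rewrite !cderiv_is_derive_AbsRing. intros Hf Hg.
  apply (is_derive_mult (K := C_AbsRing) f g z l m Hf Hg). apply Cmult_comm.
Qed.

Lemma cderiv_continuous (f : C -> C) (z l : C) :
  cderiv f z l -> forall eps, 0 < eps -> exists d, 0 < d /\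
    forall w : C, Cmod (w - z) < d -> Cmod (f w - f z) < eps.
Proof.
  intros H eps Heps. destruct (H 1 Rlt_0_1) as (d & Hd & Hw).
  pose proof (Cmod_ge_0 l) as Hl.
  assert (Hq : 0 < eps / (Cmod l + 1)) by (apply Rdiv_lt_0_compat; lra).
  exists (Rmin d (eps / (Cmod l + 1))). split; [apply Rmin_glb_lt; assumption|].
  intros w Hwd. specialize (Hw w (Rlt_le_trans _ _ _ Hwd (Rmin_l _ _))).
  pose proof (Rlt_le_trans _ _ _ Hwd (Rmin_r _ _)) as H2.
  replace (f w - f z)%C with ((f w - f z - l * (w - z)) + l * (w - z))%C by ring.
  eapply Rle_lt_trans; [apply Cmod_triangle|]. rewrite Cmod_mult.
  replace eps with (eps / (Cmod l + 1) * (Cmod l + 1)) by (field; lra).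
  apply Rle_lt_trans with (Cmod (w - z) * (Cmod l + 1)); [lra|].
  apply Rmult_lt_compat_r; lra.
Qed.

Lemma Cmod_sub_swap (a b : C) : Cmod (a - b) = Cmod (b - a).
Proof. rewrite <- Cmod_opp. f_equal. ring. Qed.

Lemma Cmod_reverse (a b : C) : Cmod a - Cmod b <= Cmod (a + b).
Proof.
  pose proof (Cmod_triangle (a + b) (- b)) as H. rewrite Cmod_opp in H.
  replace (a + b + - b)%C with a in H by ring. lra.
Qed.

Lemma Cmod_pos_neq (a : C) : 0 < Cmod a -> a <> 0.
Proof. intros H E. rewrite E, Cmod_0 in H. lra. Qed.

Lemma cderiv_inv (f : C -> C) (z l : C) :
  f z <> 0 -> cderiv f z l -> cderiv (fun w => / f w)%C z (- l / (f z * f z))%C.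
Proof.
  intros Hz Hf.
  assert (Hinv : cderiv Cinv (f z) (- / (f z * f z))%C).
  { set (a := f z) in *. pose proof (Cmod_gt_0 a) as [Ha _]. specialize (Ha Hz).
    intros eps Heps.
    (* The remainder of [1 / w] at [a] is [(w - a)^2 / (a^2 w)]. The first radius gives
       [|w| >= |a| / 2], hence a remainder of at most [2 |w - a|^2 / |a|^3]; the second makes this
       at most [eps |w - a|]. *)
    assert (Hd : 0 < Rmin (Cmod a / 2) (eps * (Cmod a ^ 3 / 2))).
    { apply Rmin_glb_lt; [lra|]. apply Rmult_lt_0_compat; [lra|].
      pose proof (pow_lt _ 3 Ha). lra. }
    eexists. split; [exact Hd|]. intros w Hw.
    pose proof (Rlt_le_trans _ _ _ Hw (Rmin_l _ _)) as H1.
    pose proof (Rlt_le_trans _ _ _ Hw (Rmin_r _ _)) as H2.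
    assert (Hwm : Cmod a / 2 <= Cmod w).
    { pose proof (Cmod_reverse a (w - a)). replace (a + (w - a))%C with w in H by ring. lra. }
    assert (Hw0 : w <> 0) by (apply Cmod_pos_neq; lra).
    replace (/ w - / a - - / (a * a) * (w - a))%C
      with ((w - a) * ((w - a) * / (a * a * w)))%C by (field; now split).
    rewrite !Cmod_mult, (Rmult_comm eps).
    apply Rmult_le_compat_l; [apply Cmod_ge_0|].
    rewrite Cmod_inv, !Cmod_mult by (repeat apply Cmult_neq_0; assumption).
    assert (Hww : 0 < Cmod w) by lra.
    assert (Haw : 0 < Cmod a * Cmod a * Cmod w) by (repeat apply Rmult_lt_0_compat; assumption).
    apply Rmult_le_reg_r with (Cmod a * Cmod a * Cmod w); [exact Haw|].
    rewrite Rmult_assoc, Rinv_l, Rmult_1_r by lra.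
    apply Rle_trans with (eps * (Cmod a ^ 3 / 2)); [lra|].
    apply Rmult_le_compat_l; [lra|]. simpl. nra. }
  apply cderiv_is_derive_AbsRing.
  apply cderiv_is_derive_AbsRing in Hf. apply cderiv_is_derive_AbsRing in Hinv.
  replace (- l / (f z * f z))%C with (l * - / (f z * f z))%C.
  2: { unfold Cdiv. ring. }
  exact (is_derive_comp (V := AbsRing_NormedModule C_AbsRing) Cinv f z _ _ Hinv Hf).
Qed.

Lemma cderiv_pow (f : C -> C) (z l : C) (n : nat) :
  cderiv f z l -> exists m, cderiv (fun w => f w ^ n)%C z m.
Proof.
  intros Hf. induction n as [|n [m IH]].
  - exists 0. apply (cderiv_const 1).
  - eexists. apply (cderiv_mult f _ z _ _ Hf IH).
Qed.

Lemma Cmod_re (z : C) : Rabs (Re z) <= Cmod z.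
Proof. eapply Rle_trans; [apply Rmax_l|apply Rmax_Cmod]. Qed.

(* Reduces to the real mean value theorem for
   [t |-> Re (conj (G b - G a) * G (a + t (b - a)))]. *)
Lemma cderiv_mean_value (G : C -> C) (a b : C) (M : R) :
  (forall t : R, 0 <= t <= 1 -> exists l : C, cderiv G (a + t * (b - a)) l /\ Cmod l <= M) ->
  Cmod (G b - G a) <= M * Cmod (b - a).
Proof.
  intros H. set (c := Cconj (G b - G a)).
  assert (HM : 0 <= M).
  { destruct (H 0) as (l & _ & Hl); [lra|]. pose proof (Cmod_ge_0 l). lra. }
  set (phi := fun t : R => Re (c * G (a + t * (b - a)))%C).
  assert (Hphi : forall t, 0 <= t <= 1 ->
    exists l, derivable_pt_lim phi t l /\ Rabs l <= Cmod c * (M * Cmod (b - a))).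
  { intros t Ht. destruct (H t Ht) as (l & Hl & Hb).
    exists (Re (c * (l * (b - a)))%C). split.
    - intros eps Heps.
      set (K := Cmod c * Cmod (b - a) + 1).
      assert (HK : 0 < K).
      { unfold K. pose proof (Cmod_ge_0 c). pose proof (Cmod_ge_0 (b - a)). nra. }
      destruct (Hl (eps / (2 * K))) as (d & Hd & Hw).
      { apply Rdiv_lt_0_compat; lra. }
      assert (Hd2 : 0 < d / (Cmod (b - a) + 1)).
      { apply Rdiv_lt_0_compat; [lra|]. pose proof (Cmod_ge_0 (b - a)). lra. }
      exists (mkposreal _ Hd2). intros h Hh Hhd. simpl in Hhd.
      assert (Ehw : (a + (t + h)%R * (b - a) - (a + t * (b - a)) = h * (b - a))%C).
      { rewrite RtoC_plus. ring. }
      specialize (Hw (a + (t + h)%R * (b - a))%C). rewrite Ehw in Hw.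
      rewrite Cmod_mult, Cmod_R in Hw.
      pose proof (Cmod_ge_0 (b - a)) as Hba. pose proof (Rabs_pos_lt h Hh) as Hh0.
      assert (HH : Rabs h * Cmod (b - a) < d).
      { apply Rle_lt_trans with (Rabs h * (Cmod (b - a) + 1)); [nra|].
        replace d with (d / (Cmod (b - a) + 1) * (Cmod (b - a) + 1)) by (field; lra).
        apply Rmult_lt_compat_r; lra. }
      specialize (Hw HH).
      set (e := (G (a + (t + h)%R * (b - a)) - G (a + t * (b - a)) - l * (h * (b - a)))%C) in *.
      replace ((phi (t + h) - phi t) / h - Re (c * (l * (b - a)))%C)
        with (Re (c * e)%C / h).
      2: { unfold phi, e.
           set (G1 := G (a + (t + h)%R * (b - a))%C). set (G0 := G (a + t * (b - a))%C).
           replace (c * (G1 - G0 - l * (h * (b - a))))%C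
             with (c * G1 - c * G0 - h * (c * (l * (b - a))))%C by ring.
           generalize (c * G1)%C (c * G0)%C (c * (l * (b - a)))%C. intros x y u.
           unfold Re. simpl. field. exact Hh. }
      unfold Rdiv. rewrite Rabs_mult, Rabs_inv.
      apply Rmult_lt_reg_r with (Rabs h); [exact Hh0|].
      rewrite Rmult_assoc, Rinv_l, Rmult_1_r by lra.
      apply Rle_lt_trans with (Cmod (c * e)); [apply Cmod_re|].
      rewrite Cmod_mult.
      apply Rle_lt_trans with (Cmod c * (eps / (2 * K) * (Rabs h * Cmod (b - a)))).
      { apply Rmult_le_compat_l; [apply Cmod_ge_0|exact Hw]. }
      replace (Cmod c * (eps / (2 * K) * (Rabs h * Cmod (b - a))))
        with (eps * Rabs h * ((Cmod c * Cmod (b - a)) / (2 * K))) by (field; lra).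
      rewrite <- (Rmult_1_r (eps * Rabs h)) at 2.
      apply Rmult_lt_compat_l; [nra|].
      apply Rmult_lt_reg_r with (2 * K); [lra|].
      unfold Rdiv. rewrite Rmult_assoc, Rinv_l by lra. unfold K in *.
      pose proof (Cmod_ge_0 c). nra.
    - eapply Rle_trans; [apply Cmod_re|]. rewrite !Cmod_mult.
      apply Rmult_le_compat_l; [apply Cmod_ge_0|].
      apply Rmult_le_compat_r; [apply Cmod_ge_0|exact Hb]. }
  assert (Hmain : phi 1 - phi 0 <= Cmod c * (M * Cmod (b - a))).
  { destruct (MVT_cor2 phi (Derive phi) 0 1 Rlt_0_1) as (t & Et & Ht).
    - intros t Ht. destruct (Hphi t Ht) as (l & Hl & _).
      apply is_derive_Reals in Hl. apply is_derive_Reals, Derive_correct. now exists l.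
    - destruct (Hphi t) as (l & Hl & Hb); [lra|].
      apply is_derive_Reals, is_derive_unique in Hl. rewrite Hl in Et.
      replace (1 - 0) with 1 in Et by ring. rewrite Et, Rmult_1_r.
      eapply Rle_trans; [apply Rle_abs|exact Hb]. }
  assert (E : phi 1 - phi 0 = Cmod c ^ 2).
  { unfold phi. replace (a + 1 * (b - a))%C with b by ring.
    replace (a + 0 * (b - a))%C with a by ring.
    transitivity (Re (c * (G b - G a))%C).
    - unfold Re. simpl. ring.
    - rewrite <- (Cconj_conj (G b - G a)). fold c. rewrite <- Cmod2_conj. reflexivity. }
  assert (Ec : Cmod (G b - G a) = Cmod c) by (unfold c; now rewrite Cmod_conj).
  rewrite Ec. rewrite E in Hmain.
  destruct (Req_dec (Cmod c) 0) as [E0|E0].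
  - rewrite E0. apply Rmult_le_pos; [exact HM|apply Cmod_ge_0].
  - pose proof (Cmod_ge_0 c). apply Rmult_le_reg_l with (Cmod c); [lra|]. simpl in Hmain. lra.
Qed.

(** * Bisection of rectangles *)

Lemma nested_intervals (a b : nat -> R) (L : R) :
  (forall n, a n <= a (S n)) -> (forall n, b (S n) <= b n) ->
  (forall n, b n - a n = L / 2 ^ n) -> 0 <= L ->
  exists x, forall n, a n <= x <= b n.
Proof.
  intros Ha Hb Hab HL.
  assert (Hle : forall n, a n <= b n).
  { intros n. specialize (Hab n). pose proof (pow_lt 2 n ltac:(lra)).
    assert (0 <= L / 2 ^ n) by (apply Rdiv_le_0_compat; lra). lra. }
  assert (Hma : forall n k, a n <= a (n + k)%nat).
  { intros n k. induction k as [|k IH]; [rewrite Nat.add_0_r; lra|].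
    rewrite Nat.add_succ_r. eapply Rle_trans; [exact IH|apply Ha]. }
  assert (Hmb : forall n k, b (n + k)%nat <= b n).
  { intros n k. induction k as [|k IH]; [rewrite Nat.add_0_r; lra|].
    rewrite Nat.add_succ_r. eapply Rle_trans; [apply Hb|exact IH]. }
  assert (Hcross : forall n m, a n <= b m).
  { intros n m. eapply Rle_trans; [apply (Hma n m)|].
    eapply Rle_trans; [apply Hle|]. rewrite Nat.add_comm. apply Hmb. }
  destruct (completeness (fun x => exists n, x = a n)) as [x [Hub Hlub]].
  - exists (b O). intros x [n ->]. apply Hcross.
  - exists (a O). now exists O.
  - exists x. intros n. split.
    + apply Hub. now exists n.
    + apply Hlub. intros y [m ->]. apply Hcross.
Qed.

(** Testing one half is enough: if [Phi] is additive and this half carries less than half of the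
    modulus, the triangle inequality gives at least half of it to the other one. *)
Definition bisect_x (Phi : R -> R -> R -> R -> C) (q : (R * R) * (R * R)) :=
  let '((a, b), (c, d)) := q in
  let m := (a + b) / 2 in
  if Rle_dec (Cmod (Phi a b c d)) (2 * Cmod (Phi a m c d))
  then ((a, m), (c, d)) else ((m, b), (c, d)).

Definition bisect_y (Phi : R -> R -> R -> R -> C) (q : (R * R) * (R * R)) :=
  let '((a, b), (c, d)) := q in
  let m := (c + d) / 2 in
  if Rle_dec (Cmod (Phi a b c d)) (2 * Cmod (Phi a b c m))
  then ((a, b), (c, m)) else ((a, b), (m, d)).

Fixpoint bisect (Phi : R -> R -> R -> R -> C) (q : (R * R) * (R * R)) (n : nat) :=
  match n with
  | O => q
  | S n => bisect_y Phi (bisect_x Phi (bisect Phi q n))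
  end.

(** Goursat's argument freed from complex analysis. After n bisections in both directions a
    rectangle remains that carries at least the share 4^(-n) of [|Phi|], while the square of its
    side sum has shrunk by the same factor. The local estimate at the common point thus bounds
    [|Phi A B P Q|] by [eps * L ^ 2] for every [eps]. *)
Lemma additive_rectangle_zero (Phi : R -> R -> R -> R -> C) (A B P Q : R) :
  A <= B -> P <= Q ->
  (forall a m b c d, A <= a -> a <= m <= b -> b <= B -> P <= c -> c <= d -> d <= Q ->
     Phi a b c d = (Phi a m c d + Phi m b c d)%C) ->
  (forall a b c m d, A <= a -> a <= b -> b <= B -> P <= c -> c <= m <= d -> d <= Q ->
     Phi a b c d = (Phi a b c m + Phi a b m d)%C) ->
  (forall x y, A <= x <= B -> P <= y <= Q -> forall eps, 0 < eps -> exists delta, 0 < delta /\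
     forall a b c d, A <= a -> a <= x <= b -> b <= B -> P <= c -> c <= y <= d -> d <= Q ->
       b - a + (d - c) < delta -> Cmod (Phi a b c d) <= eps * (b - a + (d - c)) ^ 2) ->
  Phi A B P Q = 0.
Proof.
  intros HAB HPQ Hx Hy Hloc.
  set (M := Cmod (Phi A B P Q)).
  assert (Hone : forall a b c d, A <= a -> a <= b -> b <= B -> P <= c -> c <= d -> d <= Q ->
    let '((a', b'), (c', d')) := bisect_y Phi (bisect_x Phi ((a, b), (c, d))) in
    a <= a' /\ a' <= b' /\ b' <= b /\ c <= c' /\ c' <= d' /\ d' <= d /\
    b' - a' = (b - a) / 2 /\ d' - c' = (d - c) / 2 /\
    Cmod (Phi a b c d) <= 4 * Cmod (Phi a' b' c' d')).
  { clear - Hx Hy. intros a b c d H1 H2 H3 H4 H5 H6.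
    assert (Sx : let '((a', b'), (c', d')) := bisect_x Phi ((a, b), (c, d)) in
      a <= a' /\ a' <= b' /\ b' <= b /\ c' = c /\ d' = d /\
      b' - a' = (b - a) / 2 /\ Cmod (Phi a b c d) <= 2 * Cmod (Phi a' b' c' d')).
    { simpl. destruct (Rle_dec _ _) as [Hle|Hnle].
      - repeat split; lra.
      - repeat split; try lra.
        rewrite (Hx a ((a + b) / 2) b c d) in Hnle |- * by lra.
        pose proof (Cmod_triangle (Phi a ((a + b) / 2) c d) (Phi ((a + b) / 2) b c d)). lra. }
    destruct (bisect_x Phi (a, b, (c, d))) as [[a' b'] [c' d']].
    destruct Sx as (S1 & S2 & S3 & -> & -> & S4 & S5).
    simpl. destruct (Rle_dec _ _) as [Hle|Hnle].
    - repeat split; lra.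
    - repeat split; try lra.
      rewrite (Hy a' b' c ((c + d) / 2) d) in Hnle, S5 by lra.
      pose proof (Cmod_triangle (Phi a' b' c ((c + d) / 2)) (Phi a' b' ((c + d) / 2) d)). lra. }
  set (q := bisect Phi ((A, B), (P, Q))).
  assert (Hinv : forall n, let '((a, b), (c, d)) := q n in
    A <= a /\ a <= b /\ b <= B /\ P <= c /\ c <= d /\ d <= Q /\
    b - a = (B - A) / 2 ^ n /\ d - c = (Q - P) / 2 ^ n /\
    M <= 4 ^ n * Cmod (Phi a b c d)).
  { induction n as [|n IH].
    - simpl. fold M. repeat split; lra.
    - change (q (S n)) with (bisect_y Phi (bisect_x Phi (q n))).
      destruct (q n) as [[a b] [c d]].
      destruct IH as (I1 & I2 & I3 & I4 & I5 & I6 & I7 & I8 & I9).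
      specialize (Hone a b c d I1 I2 I3 I4 I5 I6).
      destruct (bisect_y Phi (bisect_x Phi (a, b, (c, d)))) as [[a' b'] [c' d']].
      pose proof (pow_lt 4 n ltac:(lra)) as H4.
      assert (E2 : forall L, L / 2 ^ S n = L / 2 ^ n / 2).
      { intros L. simpl. field. apply pow_nonzero. lra. }
      rewrite !E2, <- I7, <- I8. repeat split; try lra.
      eapply Rle_trans; [exact I9|].
      replace (4 ^ S n) with (4 ^ n * 4) by (simpl; ring). rewrite Rmult_assoc.
      apply Rmult_le_compat_l; lra. }
  assert (Hstep : forall n, let '((a, b), (c, d)) := q n in
    let '((a', b'), (c', d')) := q (S n) in a <= a' /\ b' <= b /\ c <= c' /\ d' <= d).
  { intros n. change (q (S n)) with (bisect_y Phi (bisect_x Phi (q n))).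
    specialize (Hinv n). destruct (q n) as [[a b] [c d]].
    destruct Hinv as (I1 & I2 & I3 & I4 & I5 & I6 & _).
    specialize (Hone a b c d I1 I2 I3 I4 I5 I6).
    destruct (bisect_y Phi (bisect_x Phi (a, b, (c, d)))) as [[a' b'] [c' d']].
    repeat split; lra. }
  destruct (nested_intervals (fun n => fst (fst (q n))) (fun n => snd (fst (q n))) (B - A))
    as [x Hxn].
  1-4: try intros n; try specialize (Hstep n); try specialize (Hinv n);
    try destruct (q (S n)) as [[a' b'] [c' d']]; try destruct (q n) as [[a b] [c d]];
    simpl; lra.
  destruct (nested_intervals (fun n => fst (snd (q n))) (fun n => snd (snd (q n))) (Q - P))
    as [y Hyn].
  1-4: try intros n; try specialize (Hstep n); try specialize (Hinv n);
    try destruct (q (S n)) as [[a' b'] [c' d']]; try destruct (q n) as [[a b] [c d]];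
    simpl; lra.
  set (L := B - A + (Q - P)).
  assert (HM : forall eps, 0 < eps -> M <= eps * L ^ 2).
  { intros eps Heps.
    assert (Hx0 : A <= x <= B) by (exact (Hxn O)).
    assert (Hy0 : P <= y <= Q) by (exact (Hyn O)).
    destruct (Hloc x y Hx0 Hy0 eps Heps) as (delta & Hdelta & Hd).
    (* The number of bisections is chosen with [L / 2 ^ n < delta]; [L + 1] replaces [L] because [L]
       may be 0. *)
    destruct (pow_lt_1_zero (1 / 2) ltac:(rewrite Rabs_pos_eq; lra) (delta / (L + 1)))
      as [n Hn].
    { apply Rdiv_lt_0_compat; unfold L; lra. }
    specialize (Hn n (le_n n)). specialize (Hinv n). specialize (Hxn n). specialize (Hyn n).
    destruct (q n) as [[a b] [c d]]. simpl in Hxn, Hyn.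
    destruct Hinv as (I1 & I2 & I3 & I4 & I5 & I6 & I7 & I8 & I9).
    pose proof (pow_lt 2 n ltac:(lra)) as H2.
    assert (Epow : (1 / 2) ^ n = / 2 ^ n) by (rewrite <- pow_inv; f_equal; lra).
    rewrite Epow, Rabs_pos_eq in Hn by (left; now apply Rinv_0_lt_compat).
    assert (Elen : b - a + (d - c) = L / 2 ^ n) by (rewrite I7, I8; unfold L; field; lra).
    assert (Hlen : b - a + (d - c) < delta).
    { rewrite Elen. unfold Rdiv. pose proof (Rinv_0_lt_compat _ H2).
      apply Rle_lt_trans with ((L + 1) * / 2 ^ n); [nra|].
      replace delta with ((L + 1) * (delta / (L + 1))) by (field; unfold L; lra).
      apply Rmult_lt_compat_l; [unfold L; lra|exact Hn]. }
    specialize (Hd a b c d I1 Hxn I3 I4 Hyn I6 Hlen).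
    eapply Rle_trans; [exact I9|].
    pose proof (pow_lt 4 n ltac:(lra)) as H4.
    apply Rle_trans with (4 ^ n * (eps * (b - a + (d - c)) ^ 2)).
    { apply Rmult_le_compat_l; lra. }
    rewrite Elen. replace 4 with (2 * 2) by ring. rewrite Rpow_mult_distr.
    right. field. lra. }
  assert (HM0 : M <= 0).
  { apply Rnot_lt_le. intros HMp.
    specialize (HM (M / (2 * (L ^ 2 + 1)))).
    assert (HL : 0 < L ^ 2 + 1) by (pose proof (pow2_ge_0 L); lra).
    assert (Hq : 0 < M / (2 * (L ^ 2 + 1))) by (apply Rdiv_lt_0_compat; lra).
    specialize (HM Hq).
    assert (E : M / (2 * (L ^ 2 + 1)) * (2 * (L ^ 2 + 1)) = M) by (field; lra).
    nra. }
  apply Cmod_eq_0, Rle_antisym; [exact HM0|apply Cmod_ge_0].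
Qed.

(** * Integrals of complex-valued functions of a real variable *)

Definition rcont (g : R -> C) (t : R) : Prop :=
  forall eps, 0 < eps -> exists d, 0 < d /\
    forall s, Rabs (s - t) < d -> Cmod (g s - g t) < eps.

Lemma rcont_continuous_AbsRing (g : R -> C) (t : R) :
  rcont g t <-> continuous (T := R_UniformSpace) (U := AbsRing_UniformSpace C_AbsRing) g t.
Proof.
  unfold continuous. rewrite filterlim_locally. split.
  - intros H eps. destruct (H eps (cond_pos eps)) as (d & Hd & Hs).
    exists (mkposreal d Hd). exact Hs.
  - intros H eps Heps. destruct (H (mkposreal eps Heps)) as [d Hd].
    exists d. split; [apply cond_pos|exact Hd].
Qed.

Lemma rcont_continuous (g : R -> C) (t : R) :
  rcont g t -> continuous (T := R_UniformSpace) (U := C_R_CompleteNormedModule) g t.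
Proof.
  rewrite rcont_continuous_AbsRing. intros H P HP. apply (H P), locally_C, HP.
Qed.

Lemma rcont_const (c : C) (t : R) : rcont (fun _ => c) t.
Proof.
  intros eps Heps. exists 1. split; [lra|]. intros s _.
  replace (c - c)%C with (RtoC 0) by ring. now rewrite Cmod_0.
Qed.

Lemma rcont_plus (f g : R -> C) (t : R) :
  rcont f t -> rcont g t -> rcont (fun s => f s + g s)%C t.
Proof.
  rewrite !rcont_continuous_AbsRing.
  apply (continuous_plus (V := AbsRing_NormedModule C_AbsRing)).
Qed.

Lemma rcont_minus (f g : R -> C) (t : R) :
  rcont f t -> rcont g t -> rcont (fun s => f s - g s)%C t.
Proof.
  rewrite !rcont_continuous_AbsRing.
  apply (continuous_minus (V := AbsRing_NormedModule C_AbsRing)).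
Qed.

Lemma rcont_mult (f g : R -> C) (t : R) :
  rcont f t -> rcont g t -> rcont (fun s => f s * g s)%C t.
Proof.
  rewrite !rcont_continuous_AbsRing. apply (continuous_mult (K := C_AbsRing)).
Qed.

Lemma rcont_comp (f : C -> C) (g : R -> C) (t : R) (l : C) :
  cderiv f (g t) l -> rcont g t -> rcont (fun s => f (g s)) t.
Proof.
  intros Hf Hg eps Heps. destruct (cderiv_continuous _ _ _ Hf eps Heps) as (d & Hd & H).
  destruct (Hg d Hd) as (d' & Hd' & H'). exists d'. split; [exact Hd'|].
  intros s Hs. apply H, H', Hs.
Qed.

Lemma rcont_inv (g : R -> C) (t : R) :
  g t <> 0 -> rcont g t -> rcont (fun s => / g s)%C t.
Proof.
  intros H Hg. eapply (rcont_comp Cinv); [|exact Hg].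
  apply (cderiv_inv (fun w => w)); [exact H|apply cderiv_id].
Qed.

(** * Derivatives of paths, and integrals over a real parameter *)

Definition rderiv (p : R -> C) (t : R) (v : C) : Prop :=
  forall eps, 0 < eps -> exists d, 0 < d /\
    forall s, Rabs (s - t) < d -> Cmod (p s - p t - (s - t)%R * v) <= eps * Rabs (s - t).

Lemma rderiv_is_derive (p : R -> C) (t : R) (v : C) :
  rderiv p t v -> is_derive (K := R_AbsRing) (V := C_R_CompleteNormedModule) p t v.
Proof.
  intros H. split; [apply is_linear_scal_l|].
  intros x Hx eps. rewrite <- (is_filter_lim_locally_unique (V := R_NormedModule) t x Hx).
  destruct (H eps (cond_pos eps)) as (d & Hd & Hs).
  exists (mkposreal d Hd). intros s Hsd. specialize (Hs s Hsd).
  replace (norm _) with (Cmod (p s - p t - (s - t)%R * v)); [exact Hs|].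
  rewrite Cmod_norm. f_equal. apply injective_projections; simpl; unfold minus, plus, opp, scal; simpl;
    unfold mult; simpl; ring.
Qed.

Lemma rderiv_rcont (p : R -> C) (t : R) (v : C) : rderiv p t v -> rcont p t.
Proof.
  intros H eps Heps. destruct (H 1 Rlt_0_1) as (d & Hd & Hs).
  pose proof (Cmod_ge_0 v) as Hv.
  assert (Hq : 0 < eps / (Cmod v + 1)) by (apply Rdiv_lt_0_compat; lra).
  exists (Rmin d (eps / (Cmod v + 1))). split; [apply Rmin_glb_lt; assumption|].
  intros s Hst. specialize (Hs s (Rlt_le_trans _ _ _ Hst (Rmin_l _ _))).
  pose proof (Rlt_le_trans _ _ _ Hst (Rmin_r _ _)) as H2.
  replace (p s - p t)%C with ((p s - p t - (s - t)%R * v) + (s - t)%R * v)%C by ring.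
  eapply Rle_lt_trans; [apply Cmod_triangle|]. rewrite Cmod_mult, Cmod_R.
  replace eps with (eps / (Cmod v + 1) * (Cmod v + 1)) by (field; lra).
  apply Rle_lt_trans with (Rabs (s - t) * (Cmod v + 1)); [lra|].
  apply Rmult_lt_compat_r; lra.
Qed.

Lemma rderiv_comp (E : C -> C) (p : R -> C) (t : R) (l v : C) :
  cderiv E (p t) l -> rderiv p t v -> rderiv (fun s => E (p s)) t (l * v)%C.
Proof.
  intros HE Hp eps Heps.
  pose proof (Cmod_ge_0 v) as Hv. pose proof (Cmod_ge_0 l) as Hl.
  destruct (HE (eps / (2 * (Cmod v + 1)))) as (d1 & Hd1 & H1).
  { apply Rdiv_lt_0_compat; lra. }
  destruct (rderiv_rcont _ _ _ Hp d1 Hd1) as (d2 & Hd2 & H2).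
  (* The bound 1 makes [p] Lipschitz at [t] with constant [|v| + 1]; the other one keeps the
     contribution [l * e] below half of [eps |s - t|]. *)
  assert (He3 : 0 < Rmin 1 (eps / (2 * (Cmod l + 1)))).
  { apply Rmin_glb_lt; [lra|]. apply Rdiv_lt_0_compat; lra. }
  destruct (Hp _ He3) as (d3 & Hd3 & H3).
  exists (Rmin d2 d3). split; [apply Rmin_glb_lt; assumption|].
  intros s Hs.
  specialize (H2 s (Rlt_le_trans _ _ _ Hs (Rmin_l _ _))). specialize (H1 _ H2).
  specialize (H3 s (Rlt_le_trans _ _ _ Hs (Rmin_r _ _))).
  set (e := (p s - p t - (s - t)%R * v)%C) in *.
  pose proof (Rabs_pos (s - t)) as Hst.
  assert (H31 : Cmod e <= Rabs (s - t)).
  { eapply Rle_trans; [exact H3|]. rewrite <- (Rmult_1_l (Rabs (s - t))) at 2.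
    apply Rmult_le_compat_r; [exact Hst|apply Rmin_l]. }
  assert (H32 : Cmod e <= eps / (2 * (Cmod l + 1)) * Rabs (s - t)).
  { eapply Rle_trans; [exact H3|]. apply Rmult_le_compat_r; [exact Hst|apply Rmin_r]. }
  assert (Hps : Cmod (p s - p t) <= (Cmod v + 1) * Rabs (s - t)).
  { replace (p s - p t)%C with (e + (s - t)%R * v)%C by (unfold e; ring).
    eapply Rle_trans; [apply Cmod_triangle|]. rewrite Cmod_mult, Cmod_R. lra. }
  replace (E (p s) - E (p t) - (s - t)%R * (l * v))%C
    with ((E (p s) - E (p t) - l * (p s - p t)) + l * e)%C by (unfold e; ring).
  eapply Rle_trans; [apply Cmod_triangle|]. rewrite Cmod_mult.
  assert (Hq1 : 0 < eps / (2 * (Cmod v + 1))) by (apply Rdiv_lt_0_compat; lra).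
  apply Rle_trans with (eps / (2 * (Cmod v + 1)) * ((Cmod v + 1) * Rabs (s - t))
    + (Cmod l + 1) * (eps / (2 * (Cmod l + 1)) * Rabs (s - t))).
  - apply Rplus_le_compat.
    + eapply Rle_trans; [exact H1|]. apply Rmult_le_compat_l; lra.
    + apply Rmult_le_compat; try lra. apply Cmod_ge_0.
  - right. field. lra.
Qed.

Lemma rderiv_pair (x y : R -> R) (t dx dy : R) :
  derivable_pt_lim x t dx -> derivable_pt_lim y t dy ->
  rderiv (fun s => (x s, y s)) t (dx, dy).
Proof.
  assert (Hr : forall x dx, derivable_pt_lim x t dx -> forall eps, 0 < eps -> exists d, 0 < d /\
    forall s, Rabs (s - t) < d -> Rabs (x s - x t - (s - t) * dx) <= eps * Rabs (s - t)).
  { clear. intros x dx H eps Heps. destruct (H eps Heps) as [d Hd].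
    exists d. split; [apply cond_pos|]. intros s Hs.
    destruct (Req_dec s t) as [->|Hst].
    - replace (x t - x t - (t - t) * dx) with 0 by ring. rewrite Rminus_diag, Rabs_R0. lra.
    - specialize (Hd (s - t) ltac:(lra) Hs). replace (t + (s - t)) with s in Hd by ring.
      replace (x s - x t - (s - t) * dx) with (((x s - x t) / (s - t) - dx) * (s - t)) by (field; lra).
      rewrite Rabs_mult. apply Rmult_le_compat_r; [apply Rabs_pos|lra]. }
  intros Hx Hy eps Heps.
  destruct (Hr x dx Hx (eps / 2)) as (d1 & Hd1 & H1); [lra|].
  destruct (Hr y dy Hy (eps / 2)) as (d2 & Hd2 & H2); [lra|].
  exists (Rmin d1 d2). split; [apply Rmin_glb_lt; assumption|]. intros s Hs.
  specialize (H1 s (Rlt_le_trans _ _ _ Hs (Rmin_l _ _))).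
  specialize (H2 s (Rlt_le_trans _ _ _ Hs (Rmin_r _ _))).
  set (X := x s - x t - (s - t) * dx) in *. set (Y := y s - y t - (s - t) * dy) in *.
  replace ((x s, y s) - (x t, y t) - (s - t)%R * (dx, dy))%C with (X + Ci * Y)%C.
  2: { unfold X, Y. apply injective_projections; simpl; ring. }
  eapply Rle_trans; [apply Cmod_triangle|]. rewrite Cmod_mult, Cmod_Ci, !Cmod_R. lra.
Qed.

Definition cint (f : R -> C) (a b : R) : C := RInt (V := C_R_CompleteNormedModule) f a b.

Definition rcont_on (f : R -> C) (a b : R) := forall t, a <= t <= b -> rcont f t.

Lemma cint_is_RInt (f : R -> C) (a b : R) :
  a <= b -> rcont_on f a b -> is_RInt (V := C_R_CompleteNormedModule) f a b (cint f a b).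
Proof.
  intros Hab Hf. apply RInt_correct, (ex_RInt_continuous (V := C_R_CompleteNormedModule)).
  rewrite Rmin_left, Rmax_right by exact Hab. intros t Ht. apply rcont_continuous, Hf, Ht.
Qed.

Lemma cint_ext (f g : R -> C) (a b : R) :
  a <= b -> (forall t, a <= t <= b -> f t = g t) -> cint f a b = cint g a b.
Proof.
  intros Hab H. apply (RInt_ext (V := C_R_CompleteNormedModule)). rewrite Rmin_left, Rmax_right by exact Hab.
  intros t Ht. apply H. lra.
Qed.

Lemma cint_minus (f g : R -> C) (a b : R) :
  a <= b -> rcont_on f a b -> rcont_on g a b ->
  cint (fun t => f t - g t)%C a b = (cint f a b - cint g a b)%C.
Proof.
  intros Hab Hf Hg. apply (is_RInt_unique (V := C_R_CompleteNormedModule)).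
  apply (is_RInt_minus (V := C_R_CompleteNormedModule)); now apply cint_is_RInt.
Qed.

(** The integral lives in [C] as a real vector space, where scalars are real; a complex factor is
    handled through the real and imaginary components of the product. *)
Lemma cint_scal (c : C) (f : R -> C) (a b : R) :
  a <= b -> rcont_on f a b -> cint (fun t => c * f t)%C a b = (c * cint f a b)%C.
Proof.
  intros Hab Hf. apply (is_RInt_unique (V := C_R_CompleteNormedModule)).
  pose proof (cint_is_RInt f a b Hab Hf) as H.
  pose proof (is_RInt_fct_extend_fst _ _ _ _ H) as H1.
  pose proof (is_RInt_fct_extend_snd _ _ _ _ H) as H2.
  destruct c as [x y].
  apply (is_RInt_fct_extend_pair (U := R_NormedModule) (V := R_NormedModule)).
  - apply (is_RInt_minus (V := R_NormedModule)); apply (is_RInt_scal (V := R_NormedModule)); assumption.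
  - apply (is_RInt_plus (V := R_NormedModule)); apply (is_RInt_scal (V := R_NormedModule)); assumption.
Qed.

Lemma cint_bound (f : R -> C) (a b M : R) :
  a <= b -> rcont_on f a b -> (forall t, a <= t <= b -> Cmod (f t) <= M) ->
  Cmod (cint f a b) <= (b - a) * M.
Proof.
  intros Hab Hf HM. rewrite Cmod_norm.
  apply (norm_RInt_le_const (V := C_R_NormedModule) f a b _ M Hab).
  - intros t Ht. rewrite <- Cmod_norm. now apply HM.
  - now apply cint_is_RInt.
Qed.

Lemma cint_Chasles (f : R -> C) (a m b : R) :
  a <= m <= b -> rcont_on f a b -> cint f a b = (cint f a m + cint f m b)%C.
Proof.
  intros Hm Hf. symmetry.
  apply (RInt_Chasles (V := C_R_CompleteNormedModule)).
  - exists (cint f a m). apply cint_is_RInt; [lra|]. intros t Ht. apply Hf. lra.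
  - exists (cint f m b). apply cint_is_RInt; [lra|]. intros t Ht. apply Hf. lra.
Qed.

Lemma cint_derive (F f : R -> C) (a b : R) :
  a <= b -> rcont_on f a b -> (forall t, a <= t <= b -> rderiv F t (f t)) ->
  cint f a b = (F b - F a)%C.
Proof.
  intros Hab Hf HF. apply (is_RInt_unique (V := C_R_CompleteNormedModule)).
  apply (is_RInt_derive (V := C_R_CompleteNormedModule) F f); rewrite Rmin_left, Rmax_right by exact Hab.
  - intros t Ht. now apply rderiv_is_derive, HF.
  - intros t Ht. now apply rcont_continuous, Hf.
Qed.

(** * Goursat's theorem *)

(** The affine part of [k] has the primitive [E], so its integral depends on the end points only and
    will telescope around a closed contour. What is left is the integral of the remainder, of size
    [eta], along a path of speed at most [K]. *)
Lemma path_integral_near_affine (k : C -> C) (p p' : R -> C) (a b eta K : R) (z0 k0 k1 : C) :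
  a <= b ->
  (forall t, a <= t <= b -> rderiv p t (p' t)) -> rcont_on p' a b ->
  rcont_on (fun t => k (p t)) a b ->
  (forall t, a <= t <= b -> Cmod (k (p t) - k0 - k1 * (p t - z0)) <= eta) ->
  (forall t, a <= t <= b -> Cmod (p' t) <= K) ->
  let E := fun z : C => (k0 * z + k1 / 2 * ((z - z0) * (z - z0)))%C in
  Cmod (cint (fun t => k (p t) * p' t)%C a b - (E (p b) - E (p a))) <= (b - a) * (eta * K).
Proof.
  intros Hab Hp Hp' Hk Heta HK E.
  assert (Hpc : rcont_on p a b) by (intros t Ht; exact (rderiv_rcont _ _ _ (Hp t Ht))).
  assert (Hlin : rcont_on (fun t => (k0 + k1 * (p t - z0)) * p' t)%C a b).
  { intros t Ht. apply rcont_mult; [|now apply Hp'].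
    apply rcont_plus; [apply rcont_const|]. apply rcont_mult; [apply rcont_const|].
    apply rcont_minus; [now apply Hpc|apply rcont_const]. }
  assert (Hkp : rcont_on (fun t => k (p t) * p' t)%C a b).
  { intros t Ht. apply rcont_mult; [now apply Hk|now apply Hp']. }
  rewrite <- (cint_derive (fun t => E (p t)) (fun t => (k0 + k1 * (p t - z0)) * p' t)%C a b Hab Hlin).
  - rewrite <- cint_minus by assumption. apply cint_bound; [exact Hab| |].
    + intros t Ht. apply rcont_minus; [now apply Hkp|now apply Hlin].
    + intros t Ht.
      replace (k (p t) * p' t - (k0 + k1 * (p t - z0)) * p' t)%C
        with ((k (p t) - k0 - k1 * (p t - z0)) * p' t)%C by ring.
      rewrite Cmod_mult. apply Rmult_le_compat; try apply Cmod_ge_0; [now apply Heta|now apply HK].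
  - intros t Ht. apply (rderiv_comp E); [|now apply Hp]. unfold E.
    eapply cderiv_eq.
    + apply cderiv_plus.
      * apply cderiv_mult; [apply cderiv_const|apply cderiv_id].
      * apply cderiv_mult; [apply cderiv_const|].
        apply cderiv_mult; (apply cderiv_minus; [apply cderiv_id|apply cderiv_const]).
    + cbv beta. field.
Qed.

Lemma rderiv_scaled (z : C) (w : R -> C) (w' : C) (t th : R) :
  rderiv w th w' -> rderiv (fun s => z + t * w s)%C th (t * w')%C.
Proof.
  intros H. apply (rderiv_comp (fun x => z + t * x)%C); [|exact H].
  eapply cderiv_eq.
  - apply cderiv_plus; [apply cderiv_const|].
    apply cderiv_mult; [apply cderiv_const|apply cderiv_id].
  - cbv beta. ring.
Qed.

Lemma rderiv_RtoC (t : R) : rderiv (fun s => RtoC s) t 1.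
Proof.
  apply (rderiv_pair (fun s => s) (fun _ => 0) t 1 0);
    [apply derivable_pt_lim_id|apply derivable_pt_lim_const].
Qed.

Lemma rderiv_ray (z w : C) (t : R) : rderiv (fun s : R => z + s * w)%C t w.
Proof.
  assert (H : rderiv (fun s : R => z + s * w)%C t (w * 1)%C); [|now rewrite Cmult_1_r in H].
  apply (rderiv_comp (fun x => z + x * w)%C); [|apply rderiv_RtoC].
  eapply cderiv_eq.
  - apply cderiv_plus; [apply cderiv_const|].
    apply cderiv_mult; [apply cderiv_id|apply cderiv_const].
  - cbv beta. ring.
Qed.

Lemma rderiv_lipschitz (w w' : R -> C) (K a b : R) :
  (forall th, rderiv w th (w' th)) -> (forall th, rcont w' th) ->
  (forall th, Cmod (w' th) <= K) ->
  Cmod (w b - w a) <= K * Rabs (b - a).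
Proof.
  intros Hw Hw' HK.
  assert (H : forall a b, a <= b -> Cmod (w b - w a) <= K * (b - a)).
  { clear a b. intros a b Hab. rewrite <- (cint_derive w w' a b Hab), Rmult_comm.
    - apply cint_bound; auto. intros t _. auto.
    - intros t _. auto.
    - auto. }
  destruct (Rle_dec a b) as [Hab|Hab].
  - rewrite Rabs_pos_eq by lra. now apply H.
  - rewrite Cmod_sub_swap, Rabs_minus_sym, Rabs_pos_eq by lra. apply H. lra.
Qed.

(* Goursat's theorem on the sector [{z + t * w th | tau <= t <= 1}], whose two
   sides [th = P] and [th = Q] cancel. *)
Lemma goursat_annulus (k : C -> C) (z : C) (w w' : R -> C) (tau P Q K : R) :
  0 <= tau <= 1 -> P <= Q -> 0 < K ->
  (forall th, rderiv w th (w' th)) -> (forall th, rcont w' th) ->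
  (forall th, Cmod (w th) <= K) -> (forall th, Cmod (w' th) <= K) ->
  (forall t th, tau <= t <= 1 -> P <= th <= Q -> exists l, cderiv k (z + t * w th) l) ->
  w P = w Q ->
  cint (fun th => k (z + 1 * w th) * (1 * w' th))%C P Q =
  cint (fun th => k (z + tau * w th) * (tau * w' th))%C P Q.
Proof.
  intros Htau HPQ HK Hw Hw' HwK Hw'K Hk Hper.
  set (I1 := fun a b th => cint (fun t : R => k (z + t * w th) * w th)%C a b).
  set (I2 := fun c d (t : R) => cint (fun th => k (z + t * w th) * (t * w' th))%C c d).
  (* The integral of [k] along the boundary of the image of [[a, b] x [c, d]] under
     [(t, th) |-> z + t * w th]. Working in the parameters, this map need not be injective. *)
  set (Phi := fun a b c d => (I1 a b c + I2 c d b - I1 a b d - I2 c d a)%C).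
  assert (Hwc : forall th, rcont w th) by (intros th; exact (rderiv_rcont _ _ _ (Hw th))).
  assert (Hk1 : forall a b th, tau <= a -> b <= 1 -> P <= th <= Q ->
    rcont_on (fun t : R => k (z + t * w th)%C) a b).
  { intros a b th Ha Hb Hth t Ht. destruct (Hk t th) as [l Hl]; [lra|exact Hth|].
    apply (rcont_comp k (fun t : R => z + t * w th)%C t l Hl).
    exact (rderiv_rcont _ _ _ (rderiv_ray z (w th) t)). }
  assert (Hk2 : forall c d t, tau <= t <= 1 -> P <= c -> d <= Q ->
    rcont_on (fun th => k (z + t * w th)%C) c d).
  { intros c d t Ht Hc Hd th Hth. destruct (Hk t th) as [l Hl]; [exact Ht|lra|].
    apply (rcont_comp k (fun th => z + t * w th)%C th l Hl).
    exact (rderiv_rcont _ _ _ (rderiv_scaled z w _ t th (Hw th))). }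
  assert (Hc1 : forall a b th, tau <= a -> b <= 1 -> P <= th <= Q ->
    rcont_on (fun t : R => k (z + t * w th) * w th)%C a b).
  { intros a b th Ha Hb Hth t Ht. apply rcont_mult; [|apply rcont_const].
    exact (Hk1 a b th Ha Hb Hth t Ht). }
  assert (Hc2' : forall t th, rcont (fun th => t * w' th)%C th).
  { intros t th. apply rcont_mult; [apply rcont_const|apply Hw']. }
  assert (Hc2 : forall c d t, tau <= t <= 1 -> P <= c -> d <= Q ->
    rcont_on (fun th => k (z + t * w th) * (t * w' th))%C c d).
  { intros c d t Ht Hc Hd th Hth. apply rcont_mult; [|apply Hc2'].
    exact (Hk2 c d t Ht Hc Hd th Hth). }
  assert (H0 : Phi tau 1 P Q = 0).
  { apply additive_rectangle_zero; [lra|exact HPQ| | |].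
    - intros a m b c d H1 H2 H3 H4 H5 H6. unfold Phi, I1.
      rewrite (cint_Chasles _ a m b H2 (Hc1 a b c H1 H3 ltac:(lra))).
      rewrite (cint_Chasles _ a m b H2 (Hc1 a b d H1 H3 ltac:(lra))). ring.
    - intros a b c m d H1 H2 H3 H4 H5 H6. unfold Phi, I2.
      rewrite (cint_Chasles _ c m d H5 (Hc2 c d a ltac:(lra) H4 H6)).
      rewrite (cint_Chasles _ c m d H5 (Hc2 c d b ltac:(lra) H4 H6)). ring.
    - intros t0 th0 Ht0 Hth0 eps Heps.
      set (zeta := (z + t0 * w th0)%C).
      destruct (Hk t0 th0 Ht0 Hth0) as [k1 Hk0]. fold zeta in Hk0.
      (* Each of the four sides has parameter length at most [s] and speed at most [K], and the
         remainder on it is at most [eps / (4 K^2) * (K s)]; together they give exactly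
         [eps * s ^ 2]. *)
      destruct (Hk0 (eps / (4 * K * K))) as (dk & Hdk & Hrem).
      { apply Rdiv_lt_0_compat; nra. }
      exists (dk / K). split; [now apply Rdiv_lt_0_compat|].
      intros a b c d H1 H2 H3 H4 H5 H6 Hs.
      set (s := b - a + (d - c)) in *.
      assert (HKs : K * s < dk).
      { replace dk with (K * (dk / K)) by (field; lra). apply Rmult_lt_compat_l; lra. }
      assert (Hdist : forall t th, a <= t <= b -> c <= th <= d ->
        Cmod (z + t * w th - zeta) <= K * s).
      { intros t th Ht Hth. unfold zeta.
        replace (z + t * w th - (z + t0 * w th0))%C
          with ((t - t0)%R * w th + t0 * (w th - w th0))%C by (rewrite RtoC_minus; ring).
        eapply Rle_trans; [apply Cmod_triangle|]. rewrite !Cmod_mult, !Cmod_R.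
        pose proof (rderiv_lipschitz w w' K th0 th Hw Hw' Hw'K) as HL.
        assert (A1 : Rabs (t - t0) <= b - a) by (apply Rabs_le; lra).
        assert (A2 : Rabs (th - th0) <= d - c) by (apply Rabs_le; lra).
        rewrite (Rabs_pos_eq t0) by lra.
        apply Rle_trans with ((b - a) * K + 1 * (K * (d - c))).
        - apply Rplus_le_compat.
          + apply Rmult_le_compat; auto using Rabs_pos, Cmod_ge_0.
          + apply Rmult_le_compat; auto using Cmod_ge_0; try lra.
            eapply Rle_trans; [exact HL|]. apply Rmult_le_compat_l; lra.
        - unfold s. right. ring. }
      set (eta := eps / (4 * K * K) * (K * s)).
      assert (Heta : forall t th, a <= t <= b -> c <= th <= d ->
        Cmod (k (z + t * w th)%C - k zeta - k1 * (z + t * w th - zeta)) <= eta).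
      { intros t th Ht Hth. eapply Rle_trans.
        - apply Hrem. eapply Rle_lt_trans; [apply Hdist; assumption|exact HKs].
        - apply Rmult_le_compat_l; [|now apply Hdist]. left. apply Rdiv_lt_0_compat; nra. }
      set (E := fun x : C => (k zeta * x + k1 / 2 * ((x - zeta) * (x - zeta)))%C).
      assert (B1 : forall th, c <= th <= d ->
        Cmod (I1 a b th - (E (z + b * w th)%C - E (z + a * w th)%C)) <= s * (eta * K)).
      { intros th Hth. eapply Rle_trans.
        - apply (path_integral_near_affine k (fun t : R => z + t * w th)%C (fun _ => w th)
            a b eta K zeta (k zeta) k1).
          + lra.
          + intros t _. apply rderiv_ray.
          + intros t _. apply rcont_const.
          + apply Hk1; lra.
          + intros t Ht. now apply Heta.
          + intros t _. apply HwK.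
        - apply Rmult_le_compat_r; [|unfold s; lra].
          apply Rmult_le_pos; [|lra]. eapply Rle_trans; [apply Cmod_ge_0|apply (Heta a th); lra]. }
      assert (B2 : forall t, a <= t <= b ->
        Cmod (I2 c d t - (E (z + t * w d)%C - E (z + t * w c)%C)) <= s * (eta * K)).
      { intros t Ht. eapply Rle_trans.
        - apply (path_integral_near_affine k (fun th => z + t * w th)%C (fun th => t * w' th)%C
            c d eta K zeta (k zeta) k1).
          + lra.
          + intros th _. apply rderiv_scaled, Hw.
          + intros th _. apply Hc2'.
          + apply Hk2; lra.
          + intros th Hth. now apply Heta.
          + intros th _. rewrite Cmod_mult, Cmod_R, Rabs_pos_eq by lra.
            pose proof (Hw'K th). pose proof (Cmod_ge_0 (w' th)). nra.
        - apply Rmult_le_compat_r; [|unfold s; lra].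
          apply Rmult_le_pos; [|lra]. eapply Rle_trans; [apply Cmod_ge_0|apply (Heta a c); lra]. }
      pose proof (B1 c ltac:(lra)) as C1. pose proof (B1 d ltac:(lra)) as C2.
      pose proof (B2 a ltac:(lra)) as C3. pose proof (B2 b ltac:(lra)) as C4.
      revert C1 C2 C3 C4. clearbody I1 I2.
      match goal with |- Cmod ?x1 <= _ -> Cmod ?x2 <= _ -> Cmod ?x3 <= _ -> Cmod ?x4 <= _ -> _ =>
        set (X1 := x1); set (X2 := x2); set (X3 := x3); set (X4 := x4) end.
      intros C1 C2 C3 C4.
      (* The values of [E] at the four corners cancel in pairs. *)
      replace (Phi a b c d) with (X1 + X4 + - X2 + - X3)%C
        by (unfold Phi, X1, X2, X3, X4; ring).
      pose proof (Cmod_triangle (X1 + X4 + - X2) (- X3)) as T1.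
      pose proof (Cmod_triangle (X1 + X4) (- X2)) as T2.
      pose proof (Cmod_triangle X1 X4) as T3. rewrite !Cmod_opp in *.
      replace (eps * s ^ 2) with (4 * (s * (eta * K))) by (unfold eta; field; lra).
      lra. }
  unfold Phi in H0.
  assert (E1 : I1 tau 1 P = I1 tau 1 Q) by (unfold I1; now rewrite Hper).
  rewrite E1 in H0.
  change (I2 P Q 1 = I2 P Q tau).
  replace (I2 P Q 1) with (I1 tau 1 Q + I2 P Q 1 - I1 tau 1 Q - I2 P Q tau + I2 P Q tau)%C by ring.
  rewrite H0. ring.
Qed.

(** * Cauchy transforms on circles *)

(** Differentiation under the integral sign: a quadratic remainder that is uniform in [t] integrates
    to a quadratic remainder. *)
Lemma cderiv_cint (psi : C -> R -> C) (psi1 : R -> C) (z : C) (a b d M : R) :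
  a <= b -> 0 < d ->
  (forall w, Cmod (w - z) < d -> rcont_on (psi w) a b) -> rcont_on psi1 a b ->
  (forall w t, Cmod (w - z) < d -> a <= t <= b ->
    Cmod (psi w t - psi z t - (w - z) * psi1 t) <= M * Cmod (w - z) ^ 2) ->
  cderiv (fun w => cint (psi w) a b) z (cint psi1 a b).
Proof.
  intros Hab Hd Hc Hc1 HM eps Heps.
  (* [Rabs M] and the added 1 keep [N] positive whatever the sign of [M], also for [a = b]. *)
  set (N := (b - a) * Rabs M + 1).
  assert (HN : 0 < N) by (unfold N; pose proof (Rabs_pos M); nra).
  exists (Rmin d (eps / N)). split.
  { apply Rmin_glb_lt; [exact Hd|now apply Rdiv_lt_0_compat]. }
  intros w Hw. pose proof (Rlt_le_trans _ _ _ Hw (Rmin_l _ _)) as H1.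
  pose proof (Rlt_le_trans _ _ _ Hw (Rmin_r _ _)) as H2.
  assert (Hz : rcont_on (psi z) a b).
  { apply Hc. replace (z - z)%C with (RtoC 0) by ring. now rewrite Cmod_0. }
  assert (Hdiff : rcont_on (fun t => psi w t - psi z t)%C a b).
  { intros t Ht. apply rcont_minus; [now apply Hc|now apply Hz]. }
  assert (Hlin : rcont_on (fun t => (w - z) * psi1 t)%C a b).
  { intros t Ht. apply rcont_mult; [apply rcont_const|now apply Hc1]. }
  rewrite (Cmult_comm (cint psi1 a b)), <- cint_scal, <- !cint_minus; auto.
  pose proof (Cmod_ge_0 (w - z)) as H0.
  apply Rle_trans with ((b - a) * (M * Cmod (w - z) ^ 2)).
  - apply cint_bound; [exact Hab| |intros t Ht; now apply HM].
    intros t Ht. apply rcont_minus; [now apply Hdiff|now apply Hlin].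
  - apply Rle_trans with (N * Cmod (w - z) ^ 2).
    + rewrite <- Rmult_assoc. apply Rmult_le_compat_r; [apply pow2_ge_0|].
      unfold N. pose proof (Rle_abs M). nra.
    + replace eps with (N * (eps / N)) by (field; lra).
      replace (N * Cmod (w - z) ^ 2) with (N * Cmod (w - z) * Cmod (w - z)) by ring.
      apply Rmult_le_compat_r; [exact H0|]. apply Rmult_le_compat_l; lra.
Qed.

(** * The unit circle and the Cauchy kernel *)

Definition expi (th : R) : C := (cos th, sin th).

Lemma Cmod_expi (th : R) : Cmod (expi th) = 1.
Proof.
  unfold Cmod, expi; simpl fst; simpl snd.
  replace (_ + _) with 1; [apply sqrt_1|].
  pose proof (sin2_cos2 th) as H. unfold Rsqr in H. lra.
Qed.

Lemma rderiv_expi (th : R) : rderiv expi th (Ci * expi th)%C.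
Proof.
  replace (Ci * expi th)%C with ((- sin th, cos th)%R : C).
  - apply rderiv_pair; [apply derivable_pt_lim_cos|apply derivable_pt_lim_sin].
  - apply injective_projections; simpl; ring.
Qed.

Lemma rcont_expi (th : R) : rcont expi th.
Proof. exact (rderiv_rcont _ _ _ (rderiv_expi th)). Qed.

Lemma expi_2PI : expi 0 = expi (2 * PI).
Proof. unfold expi. now rewrite cos_2PI, sin_2PI, cos_0, sin_0. Qed.

Lemma two_PI_pos : 0 < 2 * PI.
Proof. pose proof PI_RGT_0. lra. Qed.

Lemma Cmod_circle (rho th : R) : 0 < rho -> Cmod (rho * expi th) = rho.
Proof. intros H. rewrite Cmod_mult, Cmod_R, Cmod_expi, Rabs_pos_eq; lra. Qed.

Lemma circle_distance (rho th : R) (z : C) :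
  0 < rho -> rho - Cmod z <= Cmod (rho * expi th - z).
Proof.
  intros H. pose proof (Cmod_reverse (rho * expi th) (- z)) as H1.
  rewrite Cmod_opp, Cmod_circle in H1 by exact H. exact H1.
Qed.

Lemma circle_neq (rho th : R) (z : C) :
  0 < rho -> Cmod z < rho -> (rho * expi th - z)%C <> 0.
Proof.
  intros H Hz. apply Cmod_pos_neq. pose proof (circle_distance rho th z H). lra.
Qed.

Lemma rcont_circle (rho : R) (th : R) : rcont (fun t => rho * expi t)%C th.
Proof. apply rcont_mult; [apply rcont_const|apply rcont_expi]. Qed.

Lemma rcont_cauchy_kernel (rho : R) (z : C) (th : R) :
  0 < rho -> Cmod z < rho -> rcont (fun t => / (rho * expi t - z))%C th.
Proof.
  intros H Hz. apply (rcont_inv (fun t => rho * expi t - z)%C).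
  - now apply circle_neq.
  - apply rcont_minus; [apply rcont_circle|apply rcont_const].
Qed.

Lemma rcont_bounded (phi : R -> C) (a b : R) :
  a <= b -> rcont_on phi a b -> exists M, 0 <= M /\ forall t, a <= t <= b -> Cmod (phi t) <= M.
Proof.
  intros Hab Hphi.
  destruct (continuity_ab_maj (fun t => Cmod (phi t)) a b Hab) as (m & Hm & _).
  - intros t Ht eps Heps. destruct (Hphi t Ht eps Heps) as (d & Hd & Hs).
    exists d. split; [exact Hd|]. intros s [_ Hst]. specialize (Hs s Hst).
    simpl. unfold Rdist.
    assert (Htri : forall x y : C, Cmod x - Cmod y <= Cmod (x - y)).
    { intros x y. pose proof (Cmod_reverse x (- y)). now rewrite Cmod_opp in H. }
    pose proof (Htri (phi s) (phi t)). pose proof (Htri (phi t) (phi s)) as H2.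
    rewrite (Cmod_sub_swap (phi t)) in H2.
    apply Rabs_lt_between. lra.
  - exists (Cmod (phi m)). split; [apply Cmod_ge_0|exact Hm].
Qed.

(** Cauchy transform of [phi] with respect to [th], not to the point of the circle: the factor
    [rho * expi th] of the complex line element is put into [phi] when it is wanted. The kernels of
    the next two are the first and second derivatives of this one in [z]. *)
Definition cauchy1 (phi : R -> C) (rho : R) (z : C) : C :=
  cint (fun th => phi th * / (rho * expi th - z))%C 0 (2 * PI).
Definition cauchy2 (phi : R -> C) (rho : R) (z : C) : C :=
  cint (fun th => phi th * (/ (rho * expi th - z) * / (rho * expi th - z)))%C 0 (2 * PI).
Definition cauchy3 (phi : R -> C) (rho : R) (z : C) : C :=
  cint (fun th => phi th * (2 * (/ (rho * expi th - z) *
    (/ (rho * expi th - z) * / (rho * expi th - z)))))%C 0 (2 * PI).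

Lemma kernel_bound (rho th : R) (z w : C) :
  0 < rho -> Cmod z < rho -> Cmod (w - z) < (rho - Cmod z) / 2 ->
  (rho * expi th - w)%C <> 0 /\
  Cmod (/ (rho * expi th - w)) <= 2 / (rho - Cmod z).
Proof.
  intros Hrho Hz Hw.
  pose proof (Cmod_triangle (w - z) z) as H1. replace (w - z + z)%C with w in H1 by ring.
  pose proof (circle_distance rho th w Hrho) as H2.
  assert (H3 : (rho * expi th - w)%C <> 0) by (apply Cmod_pos_neq; lra).
  split; [exact H3|]. rewrite Cmod_inv by exact H3.
  replace (2 / (rho - Cmod z)) with (/ ((rho - Cmod z) / 2)) by (field; lra).
  apply Rinv_le_contravar; lra.
Qed.

Lemma cderiv_cauchy1 (phi : R -> C) (rho : R) (z : C) :
  0 < rho -> (forall th, rcont phi th) -> Cmod z < rho ->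
  cderiv (cauchy1 phi rho) z (cauchy2 phi rho z).
Proof.
  intros Hrho Hphi Hz. pose proof two_PI_pos as Hpi.
  destruct (rcont_bounded phi 0 (2 * PI)) as (M & HM0 & HM); [lra|intros t _; apply Hphi|].
  set (q := 2 / (rho - Cmod z)).
  assert (Hq : 0 < q) by (apply Rdiv_lt_0_compat; lra).
  apply (cderiv_cint (fun w th => phi th * / (rho * expi th - w))%C _ z 0 (2 * PI)
    ((rho - Cmod z) / 2) (M * (q * (q * q)))); try lra.
  - intros w Hw t _. apply rcont_mult; [apply Hphi|].
    apply (rcont_inv (fun t => rho * expi t - w)%C).
    + now apply (kernel_bound rho t z).
    + apply rcont_minus; [apply rcont_circle|apply rcont_const].
  - intros t _. apply rcont_mult; [apply Hphi|].
    apply rcont_mult; now apply rcont_cauchy_kernel.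
  - intros w t Hw Ht.
    destruct (kernel_bound rho t z w Hrho Hz Hw) as [N1 B1].
    destruct (kernel_bound rho t z z Hrho Hz) as [N2 B2].
    { replace (z - z)%C with (RtoC 0) by ring. rewrite Cmod_0. lra. }
    fold q in B1, B2.
    (* The remainder of the kernel is [(w - z)^2] times one kernel at [w] and two at [z], each
       bounded by [q]. *)
    replace (_ - _ - _)%C
      with (phi t * (/ (rho * expi t - w) * (/ (rho * expi t - z) * / (rho * expi t - z)))
            * ((w - z) * (w - z)))%C by (field; now split).
    rewrite !Cmod_mult. replace (Cmod (w - z) ^ 2) with (Cmod (w - z) * Cmod (w - z)) by ring.
    apply Rmult_le_compat_r; [apply Rmult_le_pos; apply Cmod_ge_0|].
    repeat apply Rmult_le_compat; auto using Cmod_ge_0, Rmult_le_pos.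
Qed.

Lemma cderiv_cauchy2 (phi : R -> C) (rho : R) (z : C) :
  0 < rho -> (forall th, rcont phi th) -> Cmod z < rho ->
  cderiv (cauchy2 phi rho) z (cauchy3 phi rho z).
Proof.
  intros Hrho Hphi Hz. pose proof two_PI_pos as Hpi.
  destruct (rcont_bounded phi 0 (2 * PI)) as (M & HM0 & HM); [lra|intros t _; apply Hphi|].
  set (q := 2 / (rho - Cmod z)).
  assert (Hq : 0 < q) by (apply Rdiv_lt_0_compat; lra).
  apply (cderiv_cint
    (fun w th => phi th * (/ (rho * expi th - w) * / (rho * expi th - w)))%C _ z 0 (2 * PI)
    ((rho - Cmod z) / 2) (M * (3 * (q * (q * (q * q)))))); try lra.
  - intros w Hw t _. apply rcont_mult; [apply Hphi|].
    apply rcont_mult; (apply (rcont_inv (fun t => rho * expi t - w)%C);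
      [now apply (kernel_bound rho t z)|apply rcont_minus; [apply rcont_circle|apply rcont_const]]).
  - intros t _. apply rcont_mult; [apply Hphi|]. apply rcont_mult; [apply rcont_const|].
    repeat apply rcont_mult; now apply rcont_cauchy_kernel.
  - intros w t Hw Ht.
    destruct (kernel_bound rho t z w Hrho Hz Hw) as [N1 B1].
    destruct (kernel_bound rho t z z Hrho Hz) as [N2 B2].
    { replace (z - z)%C with (RtoC 0) by ring. rewrite Cmod_0. lra. }
    fold q in B1, B2.
    set (u := (/ (rho * expi t - w))%C) in *. set (v := (/ (rho * expi t - z))%C) in *.
    (* Using [u - v = (w - z) u v] twice, [u^2 - v^2 - 2 (w - z) v^3] becomes
       [(w - z)^2 (u^2 v^2 + 2 u v^3)]; hence the constant [3 q^4]. *)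
    replace (_ - _ - _)%C
      with (phi t * (u * (u * (v * v)) + 2 * (u * (v * (v * v)))) * ((w - z) * (w - z)))%C
      by (unfold u, v; field; now split).
    rewrite !Cmod_mult. replace (Cmod (w - z) ^ 2) with (Cmod (w - z) * Cmod (w - z)) by ring.
    apply Rmult_le_compat_r; [apply Rmult_le_pos; apply Cmod_ge_0|].
    apply Rmult_le_compat; auto using Cmod_ge_0.
    eapply Rle_trans; [apply Cmod_triangle|].
    rewrite !Cmod_mult, Cmod_R, Rabs_pos_eq by lra.
    pose proof (Cmod_ge_0 u). pose proof (Cmod_ge_0 v).
    assert (B3 : Cmod u * (Cmod u * (Cmod v * Cmod v)) <= q * (q * (q * q)))
      by (repeat apply Rmult_le_compat; auto using Rmult_le_pos).
    assert (B4 : Cmod u * (Cmod v * (Cmod v * Cmod v)) <= q * (q * (q * q)))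
      by (repeat apply Rmult_le_compat; auto using Rmult_le_pos).
    lra.
Qed.

(** * Cauchy's formula *)

(** The derivative in [z] is the integral of the derivative of the periodic function
    [Ci / (rho * expi th - z)], hence 0. The transform is therefore constant on the disk, and at
    [z = 0] its integrand is 1. *)
Lemma cauchy1_circle (rho : R) (z : C) :
  0 < rho -> Cmod z < rho -> cauchy1 (fun th => rho * expi th)%C rho z = RtoC (2 * PI).
Proof.
  intros Hrho Hz. pose proof two_PI_pos as Hpi.
  set (phi := fun th => (rho * expi th)%C).
  assert (Hphi : forall th, rcont phi th) by (intros th; apply rcont_circle).
  assert (H2 : forall x, Cmod x < rho -> cauchy2 phi rho x = 0).
  { intros x Hx. unfold cauchy2.
    rewrite (cint_derive (fun th => Ci * / (rho * expi th - x))%C).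
    - rewrite <- expi_2PI. ring.
    - lra.
    - intros t _. apply rcont_mult; [apply Hphi|].
      apply rcont_mult; now apply rcont_cauchy_kernel.
    - intros t _. pose proof (circle_neq rho t x Hrho Hx) as Hne.
      assert (Hd : cderiv (fun y => Ci * / (rho * y - x))%C (expi t)
        (Ci * (- rho / ((rho * expi t - x) * (rho * expi t - x))))%C).
      { eapply cderiv_eq.
        - apply cderiv_mult; [apply cderiv_const|].
          apply (cderiv_inv (fun y => rho * y - x)%C); [exact Hne|].
          apply cderiv_minus; [|apply cderiv_const].
          apply cderiv_mult; [apply cderiv_const|apply cderiv_id].
        - cbv beta. field. exact Hne. }
      pose proof (rderiv_comp _ expi t _ _ Hd (rderiv_expi t)) as H.
      replace (phi t * _)%C with (Ci * (- rho / ((rho * expi t - x) * (rho * expi t - x))) * (Ci * expi t))%C;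
        [exact H|].
      unfold phi. transitivity (- (Ci * Ci) * (rho * expi t / ((rho * expi t - x) * (rho * expi t - x))))%C.
      + field. exact Hne.
      + replace (Ci * Ci)%C with (- (1))%C by (apply injective_projections; simpl; ring).
        field. exact Hne. }
  assert (H0 : cauchy1 phi rho 0 = RtoC (2 * PI)).
  { unfold cauchy1. rewrite (cint_derive (fun s => RtoC s)).
    - rewrite <- RtoC_minus. f_equal. ring.
    - lra.
    - intros t _. apply rcont_mult; [apply Hphi|apply rcont_cauchy_kernel; [exact Hrho|]].
      now rewrite Cmod_0.
    - intros t _. pose proof (circle_neq rho t 0 Hrho ltac:(now rewrite Cmod_0)) as Hne.
      replace (phi t * _)%C with (RtoC 1); [apply rderiv_RtoC|].
      unfold phi. replace (rho * expi t - 0)%C with (rho * expi t)%C in * by ring.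
      field. split; intros E; apply Hne; rewrite E; ring. }
  rewrite <- H0.
  assert (Hm : Cmod (cauchy1 phi rho z - cauchy1 phi rho 0) <= 0 * Cmod (z - 0)).
  { apply cderiv_mean_value. intros t Ht. exists 0. split; [|rewrite Cmod_0; lra].
    assert (Ht' : Cmod (0 + t * (z - 0)) < rho).
    { replace (0 + t * (z - 0))%C with (t * z)%C by ring.
      rewrite Cmod_mult, Cmod_R, Rabs_pos_eq by lra. pose proof (Cmod_ge_0 z). nra. }
    eapply cderiv_eq; [now apply cderiv_cauchy1|exact (H2 _ Ht')]. }
  rewrite Rmult_0_l in Hm.
  assert (E : (cauchy1 phi rho z - cauchy1 phi rho 0)%C = 0).
  { apply Cmod_eq_0, Rle_antisym; [exact Hm|apply Cmod_ge_0]. }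
  replace (cauchy1 phi rho z) with (cauchy1 phi rho z - cauchy1 phi rho 0 + cauchy1 phi rho 0)%C by ring.
  rewrite E. ring.
Qed.

Definition holomorphic (f : C -> C) : Prop := forall z, Cmod z < 1 -> exists l, cderiv f z l.

Lemma rcont_on_circle (f : C -> C) (rho th : R) :
  holomorphic f -> 0 < rho < 1 -> rcont (fun t => f (rho * expi t)%C) th.
Proof.
  intros Hf Hrho. destruct (Hf (rho * expi th)%C) as [l Hl].
  - rewrite Cmod_circle; lra.
  - apply (rcont_comp f (fun t => rho * expi t)%C th l Hl). apply rcont_circle.
Qed.

(** Goursat's theorem for [f x / (x - z)] moves the circle to its image [z + tau * w th] under a
    contraction towards [z], with [tau > 0] because of the pole. As [tau] tends to 0 the integral
    tends to [f z] times that of [w' / w], which is known from the case of a constant [f]. *)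
Lemma cauchy_formula (f : C -> C) (rho : R) (z : C) :
  holomorphic f -> 0 < rho < 1 -> Cmod z < rho ->
  cauchy1 (fun th => f (rho * expi th) * (rho * expi th))%C rho z = (2 * PI * f z)%C.
Proof.
  intros Hf Hrho Hz. pose proof two_PI_pos as Hpi.
  set (w := fun th => (rho * expi th - z)%C).
  set (w' := fun th => (rho * (Ci * expi th))%C).
  (* The logarithmic derivative of the contour; it is the same for every contracted contour, since
     [t] cancels in [(t w') / (t w)]. *)
  set (g := fun th => (/ w th * w' th)%C).
  set (B := rho / (rho - Cmod z)).
  assert (HB : 0 < B) by (apply Rdiv_lt_0_compat; lra).
  assert (Hw0 : forall th, w th <> 0) by (intros th; apply circle_neq; lra).
  assert (Hw' : forall th, Cmod (w' th) = rho).
  { intros th. unfold w'. rewrite !Cmod_mult, Cmod_R, Cmod_Ci, Cmod_expi, Rabs_pos_eq; lra. }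
  assert (Hwd : forall th, rderiv w th (w' th)).
  { intros th. apply (rderiv_comp (fun x => rho * x - z)%C); [|apply rderiv_expi].
    eapply cderiv_eq.
    - apply cderiv_minus; [|apply cderiv_const].
      apply cderiv_mult; [apply cderiv_const|apply cderiv_id].
    - cbv beta. ring. }
  assert (Hwc' : forall th, rcont w' th).
  { intros th. repeat apply rcont_mult; try apply rcont_const. apply rcont_expi. }
  assert (Hgc : forall th, rcont g th).
  { intros th. apply rcont_mult; [apply rcont_inv; [apply Hw0|]|apply Hwc'].
    exact (rderiv_rcont _ _ _ (Hwd th)). }
  assert (Hg : forall th, Cmod (g th) <= B).
  { intros th. unfold g. rewrite Cmod_mult, Hw', Cmod_inv by apply Hw0.
    unfold B, Rdiv. rewrite Rmult_comm. apply Rmult_le_compat_l; [lra|].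
    apply Rinv_le_contravar; [lra|]. apply circle_distance. lra. }
  assert (Hin : forall t th, 0 <= t <= 1 -> Cmod (z + t * w th) < 1).
  { intros t th Ht. unfold w.
    replace (z + t * (rho * expi th - z))%C with ((1 - t)%R * z + t * (rho * expi th))%C
      by (rewrite RtoC_minus; ring).
    eapply Rle_lt_trans; [apply Cmod_triangle|].
    rewrite !Cmod_mult, Cmod_expi, !Cmod_R, !Rabs_pos_eq by lra.
    pose proof (Cmod_ge_0 z). nra. }
  assert (Hfc : forall t, 0 <= t <= 1 -> rcont_on (fun th => f (z + t * w th)%C) 0 (2 * PI)).
  { intros t Ht th _. destruct (Hf _ (Hin t th Ht)) as [l Hl].
    apply (rcont_comp f (fun th => z + t * w th)%C th l Hl).
    exact (rderiv_rcont _ _ _ (rderiv_scaled z w _ t th (Hwd th))). }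
  assert (Htau : forall tau, 0 < tau <= 1 ->
    cint (fun th => f (z + 1 * w th) * g th)%C 0 (2 * PI) =
    cint (fun th => f (z + tau * w th) * g th)%C 0 (2 * PI)).
  { intros tau Htau.
    (* The speed constant 2 suffices: [|w| <= rho + |z| < 2] and [|w'| = rho]. *)
    pose proof (goursat_annulus (fun x => f x * / (x - z))%C z w w' tau 0 (2 * PI) 2) as HG.
    assert (Hsimp : forall t, 0 < t <= 1 ->
      cint (fun th => f (z + t * w th) * g th)%C 0 (2 * PI) =
      cint (fun th => f (z + t * w th) * / (z + t * w th - z) * (t * w' th))%C 0 (2 * PI)).
    { intros t Ht. apply cint_ext; [lra|]. intros th _. unfold g.
      replace (z + t * w th - z)%C with (t * w th)%C by ring.
      field. split; [apply Hw0|]. intros E. apply RtoC_inj in E. lra. }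
    rewrite !Hsimp by lra. apply HG; try lra.
    - exact Hwd.
    - exact Hwc'.
    - intros th. unfold w. unfold Cminus. eapply Rle_trans; [apply Cmod_triangle|].
      rewrite Cmod_opp, Cmod_circle; lra.
    - intros th. rewrite Hw'. lra.
    - intros t th Ht _. destruct (Hf _ (Hin t th ltac:(lra))) as [l Hl].
      eexists. apply cderiv_mult; [exact Hl|]. apply (cderiv_inv (fun x => x - z)%C).
      + replace (z + t * w th - z)%C with (t * w th)%C by ring.
        apply Cmult_neq_0; [|apply Hw0]. intros E. apply RtoC_inj in E. lra.
      + apply cderiv_minus; [apply cderiv_id|apply cderiv_const].
    - unfold w. now rewrite expi_2PI. }
  assert (Hlim : cint (fun th => f (z + 1 * w th) * g th)%C 0 (2 * PI) =
    (f z * cint g 0 (2 * PI))%C).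
  { rewrite <- cint_scal; [|lra|intros th _; apply Hgc].
    set (X := cint (fun th => f (z + 1 * w th) * g th)%C 0 (2 * PI)).
    set (Y := cint (fun th => f z * g th)%C 0 (2 * PI)).
    assert (Hle : forall eps, 0 < eps -> Cmod (X - Y) <= 2 * PI * (eps * B)).
    { intros eps Heps. destruct (Hf z ltac:(lra)) as [l Hl].
      destruct (cderiv_continuous _ _ _ Hl eps Heps) as (d & Hd & Hc).
      (* As [|w| <= 2], this keeps [tau * w th] within distance [d]. *)
      set (tau := Rmin 1 (d / 3)).
      assert (Ht : 0 < tau <= 1 /\ tau <= d / 3).
      { unfold tau. repeat split; [apply Rmin_glb_lt; lra|apply Rmin_l|apply Rmin_r]. }
      assert (HfY : rcont_on (fun th => f z * g th)%C 0 (2 * PI)).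
      { intros th _. apply rcont_mult; [apply rcont_const|apply Hgc]. }
      assert (HfX : rcont_on (fun th => f (z + tau * w th) * g th)%C 0 (2 * PI)).
      { intros th Hth. apply rcont_mult; [apply Hfc; lra|apply Hgc]. }
      unfold X, Y. rewrite (Htau tau) by lra. rewrite <- cint_minus by (assumption || lra).
      replace (2 * PI * (eps * B)) with ((2 * PI - 0) * (eps * B)) by ring. apply cint_bound; [lra| |].
      - intros th Hth. apply rcont_minus; [now apply HfX|now apply HfY].
      - intros th _.
        replace (f (z + tau * w th) * g th - f z * g th)%C
          with ((f (z + tau * w th)%C - f z) * g th)%C by ring.
        rewrite Cmod_mult. apply Rmult_le_compat; try apply Cmod_ge_0; [|apply Hg].
        left. apply Hc. replace (z + tau * w th - z)%C with (tau * w th)%C by ring.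
        rewrite Cmod_mult, Cmod_R, Rabs_pos_eq by lra.
        assert (Cmod (w th) <= 2).
        { unfold w, Cminus. eapply Rle_trans; [apply Cmod_triangle|].
          rewrite Cmod_opp, Cmod_circle; lra. }
        pose proof (Cmod_ge_0 (w th)). nra. }
    assert (Hz0 : Cmod (X - Y) <= 0).
    { apply Rnot_lt_le. intros Hp.
      specialize (Hle (Cmod (X - Y) / (2 * (2 * PI * B)))).
      assert (HPB : 0 < 2 * PI * B) by (apply Rmult_lt_0_compat; lra).
      specialize (Hle ltac:(apply Rdiv_lt_0_compat; lra)).
      replace (2 * PI * (Cmod (X - Y) / (2 * (2 * PI * B)) * B)) with (Cmod (X - Y) / 2) in Hle
        by (field; lra). lra. }
    assert (E : (X - Y)%C = 0) by (apply Cmod_eq_0, Rle_antisym; [exact Hz0|apply Cmod_ge_0]).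
    replace X with (X - Y + Y)%C by ring. rewrite E. ring. }
  assert (Hone : forall phi : R -> C, (forall th, rcont phi th) ->
    cint (fun th => phi th * g th)%C 0 (2 * PI) =
    (Ci * cauchy1 (fun th => phi th * (rho * expi th))%C rho z)%C).
  { intros phi Hphi. unfold cauchy1. rewrite <- cint_scal.
    - apply cint_ext; [lra|]. intros th _. unfold g, w', w. ring.
    - lra.
    - intros th _. apply rcont_mult; [|apply rcont_cauchy_kernel; lra].
      apply rcont_mult; [apply Hphi|apply rcont_circle]. }
  assert (HN : cint g 0 (2 * PI) = (Ci * RtoC (2 * PI))%C).
  { rewrite <- (cauchy1_circle rho z) by lra.
    rewrite (cint_ext g (fun th => 1 * g th)%C) by (lra || (intros; ring)).
    rewrite (Hone (fun _ => 1)) by (intros; apply rcont_const).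
    f_equal. unfold cauchy1. apply cint_ext; [lra|]. intros. ring. }
  rewrite HN in Hlim.
  assert (Hl2 : cint (fun th => f (z + 1 * w th) * g th)%C 0 (2 * PI) =
    (Ci * cauchy1 (fun th => f (rho * expi th) * (rho * expi th))%C rho z)%C).
  { rewrite <- (Hone (fun th => f (rho * expi th)%C)).
    - apply cint_ext; [lra|]. intros th _.
      replace (z + 1 * w th)%C with (rho * expi th)%C by (unfold w; ring). reflexivity.
    - intros th. now apply rcont_on_circle. }
  rewrite Hl2 in Hlim.
  assert (HCi : forall x : C, (- Ci * (Ci * x) = x)%C).
  { intros x. replace (- Ci * (Ci * x))%C with (- (Ci * Ci) * x)%C by ring.
    replace (Ci * Ci)%C with (- (1))%C by (apply injective_projections; simpl; ring). ring. }
  rewrite <- (HCi (cauchy1 _ rho z)), Hlim.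
  replace (- Ci * (f z * (Ci * RtoC (2 * PI))))%C with (- Ci * (Ci * (RtoC (2 * PI) * f z)))%C by ring.
  rewrite HCi, RtoC_mult. reflexivity.
Qed.

(** * Regularity of holomorphic functions and the maximum principle *)

Lemma holomorphic_cderiv (f : C -> C) (z : C) :
  holomorphic f -> Cmod z < 1 -> cderiv f z (C_derive f z).
Proof. intros Hf Hz. destruct (Hf z Hz) as [l Hl]. exact (cderiv_C_derive _ _ _ Hl). Qed.

Lemma two_PI_neq : RtoC (2 * PI) <> 0.
Proof. intros E. apply RtoC_inj in E. pose proof two_PI_pos. lra. Qed.

Lemma ball_in_disk (rho : R) (z w : C) : Cmod (w - z) < rho - Cmod z -> Cmod w < rho.
Proof.
  intros H. replace w with (w - z + z)%C by ring.
  eapply Rle_lt_trans; [apply Cmod_triangle|]. lra.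
Qed.

Lemma rcont_circle_moment (f : C -> C) (rho : R) (th : R) :
  holomorphic f -> 0 < rho < 1 -> rcont (fun t => f (rho * expi t) * (rho * expi t))%C th.
Proof.
  intros Hf Hrho. apply rcont_mult; [now apply rcont_on_circle|apply rcont_circle].
Qed.

Lemma cauchy_formula_derive (f : C -> C) (rho : R) (z : C) :
  holomorphic f -> 0 < rho < 1 -> Cmod z < rho ->
  cderiv f z (/ RtoC (2 * PI) * cauchy2 (fun th => f (rho * expi th) * (rho * expi th)) rho z)%C.
Proof.
  intros Hf Hrho Hz.
  set (phi := fun th => (f (rho * expi th) * (rho * expi th))%C).
  apply (cderiv_ext_ball (fun w => / RtoC (2 * PI) * cauchy1 phi rho w)%C f z _ (rho - Cmod z)).
  - lra.
  - intros w Hw. apply ball_in_disk in Hw. unfold phi.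
    rewrite cauchy_formula by assumption. rewrite <- RtoC_mult. field. apply two_PI_neq.
  - eapply cderiv_eq.
    + apply cderiv_mult; [apply cderiv_const|]. apply cderiv_cauchy1; [lra| |exact Hz].
      intros th. now apply rcont_circle_moment.
    + cbv beta. ring.
Qed.

(** Near [z] the derivative is a multiple of the transform [cauchy2] over a circle that separates
    [z] from the unit circle, and this transform is differentiable in turn. *)
Lemma holomorphic_derive (f : C -> C) : holomorphic f -> holomorphic (C_derive f).
Proof.
  intros Hf z Hz. pose proof (Cmod_ge_0 z).
  set (rho := (1 + Cmod z) / 2). assert (Hrho : 0 < rho < 1) by (unfold rho; lra).
  assert (Hzr : Cmod z < rho) by (unfold rho; lra).
  set (phi := fun th => (f (rho * expi th) * (rho * expi th))%C).
  eexists.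
  apply (cderiv_ext_ball (fun w => / RtoC (2 * PI) * cauchy2 phi rho w)%C _ z _ (rho - Cmod z)).
  - lra.
  - intros w Hw. apply ball_in_disk in Hw. symmetry.
    apply cderiv_unique. now apply cauchy_formula_derive.
  - apply cderiv_mult; [apply cderiv_const|]. apply cderiv_cauchy2; [lra| |exact Hzr].
    intros th. now apply rcont_circle_moment.
Qed.

Definition diff_quotient (f : C -> C) (z : C) : C :=
  if Ceq_dec z 0 then C_derive f 0 else ((f z - f 0) / z)%C.

Lemma diff_quotient_mult (f : C -> C) (z : C) : f z = (f 0 + z * diff_quotient f z)%C.
Proof.
  unfold diff_quotient. destruct (Ceq_dec z 0) as [->|Hz]; [ring|]. field. exact Hz.
Qed.

(** For x on the circle, [1 / (x - z) - 1 / x = z / (x (x - z))]. Subtracting two Cauchy formulas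
    and dividing by [z] thus leaves a Cauchy transform, which has no singularity at 0; its value
    there is the derivative. *)
Lemma cauchy_diff_quotient (f : C -> C) (rho : R) (z : C) :
  holomorphic f -> 0 < rho < 1 -> Cmod z < rho ->
  diff_quotient f z = (/ RtoC (2 * PI) * cauchy1 (fun th => f (rho * expi th)) rho z)%C.
Proof.
  intros Hf Hrho Hz. pose proof two_PI_pos as Hpi.
  assert (H0 : Cmod 0 < rho) by (rewrite Cmod_0; lra).
  assert (Hne : forall x th, Cmod x < rho -> (rho * expi th - x)%C <> 0).
  { intros x th Hx. apply circle_neq; lra. }
  unfold diff_quotient. destruct (Ceq_dec z 0) as [->|Hz0].
  - rewrite (cderiv_unique _ _ _ (cauchy_formula_derive f rho 0 Hf Hrho H0)).
    f_equal. unfold cauchy2, cauchy1. apply cint_ext; [lra|]. intros th _.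
    pose proof (Hne 0 th H0) as N. replace (rho * expi th - 0)%C with (rho * expi th)%C in * by ring.
    field. split; intros E; apply N; rewrite E; ring.
  - set (phi := fun th => (f (rho * expi th) * (rho * expi th))%C).
    assert (E : forall x, Cmod x < rho -> f x = (/ RtoC (2 * PI) * cauchy1 phi rho x)%C).
    { intros x Hx. unfold phi. rewrite cauchy_formula by assumption.
      rewrite <- RtoC_mult. field. apply two_PI_neq. }
    assert (Hc : forall x, Cmod x < rho ->
      rcont_on (fun th => phi th * / (rho * expi th - x))%C 0 (2 * PI)).
    { intros x Hx th _. apply rcont_mult; [now apply rcont_circle_moment|].
      apply rcont_cauchy_kernel; lra. }
    rewrite (E z Hz), (E 0 H0).
    replace (/ RtoC (2 * PI) * cauchy1 phi rho z - / RtoC (2 * PI) * cauchy1 phi rho 0)%C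
      with (/ RtoC (2 * PI) * (cauchy1 phi rho z - cauchy1 phi rho 0))%C by ring.
    replace (cauchy1 phi rho z - cauchy1 phi rho 0)%C
      with (z * cauchy1 (fun th => f (rho * expi th)%C) rho z)%C.
    { field. split; [apply two_PI_neq|exact Hz0]. }
    unfold cauchy1. rewrite <- cint_minus by (lra || now apply Hc).
    rewrite <- cint_scal.
    + apply cint_ext; [lra|]. intros th _. unfold phi.
      pose proof (Hne 0 th H0) as N0. pose proof (Hne z th Hz) as Nz.
      replace (rho * expi th - 0)%C with (rho * expi th)%C in * by ring.
      field. repeat split; try exact Nz; intros E'; apply N0; rewrite E'; ring.
    + lra.
    + intros th _. apply rcont_mult; [now apply rcont_on_circle|].
      apply rcont_cauchy_kernel; lra.
Qed.

Lemma holomorphic_diff_quotient (f : C -> C) : holomorphic f -> holomorphic (diff_quotient f).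
Proof.
  intros Hf z Hz. pose proof (Cmod_ge_0 z).
  set (rho := (1 + Cmod z) / 2). assert (Hrho : 0 < rho < 1) by (unfold rho; lra).
  assert (Hzr : Cmod z < rho) by (unfold rho; lra).
  eexists.
  apply (cderiv_ext_ball
    (fun w => / RtoC (2 * PI) * cauchy1 (fun th => f (rho * expi th)%C) rho w)%C _ z _ (rho - Cmod z)).
  - lra.
  - intros w Hw. apply ball_in_disk in Hw. symmetry. now apply cauchy_diff_quotient.
  - apply cderiv_mult; [apply cderiv_const|]. apply cderiv_cauchy1; [lra| |exact Hzr].
    intros th. now apply rcont_on_circle.
Qed.

(** If [M < x], the powers of [x / M] outgrow any constant; for [M = 0] the exponent 1 already
    decides. *)
Lemma pow_bounded_le (x M B : R) :
  0 <= x -> 0 <= M -> (forall n, x ^ n <= B * M ^ n) -> x <= M.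
Proof.
  intros Hx HM H. apply Rnot_lt_le. intros Hlt.
  destruct (Req_dec M 0) as [->|HM0].
  { specialize (H 1%nat). simpl in H. lra. }
  set (r := x / M).
  assert (Hr : 1 < r).
  { unfold r. apply Rmult_lt_reg_r with M; [lra|]. unfold Rdiv.
    rewrite Rmult_assoc, Rinv_l by lra. lra. }
  destruct (Pow_x_infinity r) with (b := Rabs B + 1) as [n Hn].
  { rewrite Rabs_pos_eq; lra. }
  specialize (Hn n (le_n n)). specialize (H n).
  assert (Hp : 0 < M ^ n) by (apply pow_lt; lra).
  rewrite Rabs_pos_eq in Hn by (apply pow_le; lra).
  assert (E : x ^ n = r ^ n * M ^ n).
  { unfold r. rewrite <- Rpow_mult_distr. f_equal. field. lra. }
  rewrite E in H. apply Rmult_le_reg_r in H; [|exact Hp].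
  pose proof (Rle_abs B). lra.
Qed.

(* Cauchy's formula loses a factor [rho / (rho - |z|)], which disappears on
   applying it to the powers of [f]. *)
Lemma maximum_modulus (f : C -> C) (rho M : R) (z : C) :
  holomorphic f -> 0 < rho < 1 -> Cmod z < rho -> 0 <= M ->
  (forall w, Cmod w = rho -> Cmod (f w) <= M) -> Cmod (f z) <= M.
Proof.
  intros Hf Hrho Hz HM HfM. pose proof two_PI_pos as Hpi.
  apply (pow_bounded_le _ M (rho / (rho - Cmod z))); [apply Cmod_ge_0|exact HM|].
  intros n.
  assert (Hfn : holomorphic (fun w => f w ^ n)%C).
  { intros w Hw. destruct (Hf w Hw) as [l Hl]. exact (cderiv_pow f w l n Hl). }
  pose proof (cauchy_formula _ rho z Hfn Hrho Hz) as HC. unfold cauchy1 in HC.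
  rewrite <- RtoC_mult in HC.
  assert (HB : Cmod (RtoC (2 * PI) * f z ^ n) <=
    (2 * PI - 0) * (M ^ n * rho * / (rho - Cmod z))).
  { rewrite <- HC. apply cint_bound; [lra| |].
    - intros th _. apply rcont_mult; [now apply (rcont_circle_moment (fun w => f w ^ n)%C)|].
      apply rcont_cauchy_kernel; lra.
    - intros th _. assert (N : (rho * expi th - z)%C <> 0) by (apply circle_neq; lra).
      rewrite !(Cmod_mult (_ * _)), (Cmod_mult (_ ^ _)), Cmod_pow, Cmod_circle by lra.
      rewrite Cmod_inv by exact N.
      apply Rmult_le_compat.
      + apply Rmult_le_pos; [apply pow_le, Cmod_ge_0|lra].
      + left. apply Rinv_0_lt_compat. now apply Cmod_gt_0.
      + apply Rmult_le_compat_r; [lra|]. apply pow_incr. split; [apply Cmod_ge_0|].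
        apply HfM, Cmod_circle. lra.
      + apply Rinv_le_contravar; [lra|]. apply circle_distance. lra. }
  rewrite Cmod_mult, Cmod_R, Cmod_pow, Rabs_pos_eq in HB by lra.
  apply Rmult_le_reg_l with (2 * PI); [lra|].
  eapply Rle_trans; [exact HB|]. right. field. lra.
Qed.

(** * The class M *)

(** From [f' = (u - z u') / u^2] the term [f' (z / f)^2] is [u - z u'], so the expression becomes
    affine in [u]. *)
Lemma M_expr_of_inverse (f u u1 u2 : C -> C) :
  (forall z, Cmod z < 1 -> cderiv u z (u1 z)) ->
  (forall z, Cmod z < 1 -> cderiv u1 z (u2 z)) ->
  u 0 = 1 -> (forall z, Cmod z < 1 -> u z <> 0) ->
  (forall z, Cmod z < 1 -> f z = z / u z)%C ->
  forall z, Cmod z < 1 ->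
    cderiv f z ((u z - z * u1 z) / u z ^ 2)%C /\
    M_expr f z = (z ^ 2 * u2 z - z * u1 z + u z - 1)%C.
Proof.
  intros Hu Hu1 Hu0 Hne Hf z Hz.
  assert (Hin : forall z w : C, Cmod (w - z) < 1 - Cmod z -> Cmod w < 1).
  { intros x w. apply (ball_in_disk 1). }
  assert (Hfd : cderiv f z ((u z - z * u1 z) / u z ^ 2)%C).
  { apply (cderiv_ext_ball (fun w => w * / u w)%C f z _ (1 - Cmod z)); [lra| |].
    - intros w Hw. symmetry. apply Hf, (Hin z), Hw.
    - eapply cderiv_eq.
      + apply cderiv_mult; [apply cderiv_id|]. apply cderiv_inv; [now apply Hne|now apply Hu].
      + cbv beta. field. now apply Hne. }
  split; [exact Hfd|].
  assert (Hzo : forall w, Cmod w < 1 -> z_over f w = u w).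
  { intros w Hw. unfold z_over. destruct (Ceq_dec w 0) as [->|Hw0]; [now symmetry|].
    rewrite Hf by exact Hw. field. split; [now apply Hne|exact Hw0]. }
  assert (Hzo1 : forall w, Cmod w < 1 -> C_derive (z_over f) w = u1 w).
  { intros w Hw. apply cderiv_unique.
    apply (cderiv_ext_ball u _ w _ (1 - Cmod w)); [lra| |now apply Hu].
    intros x Hx. symmetry. apply Hzo, (Hin w), Hx. }
  assert (Hzo2 : C_derive (C_derive (z_over f)) z = u2 z).
  { apply cderiv_unique.
    apply (cderiv_ext_ball u1 _ z _ (1 - Cmod z)); [lra| |now apply Hu1].
    intros x Hx. symmetry. apply Hzo1, (Hin z), Hx. }
  unfold M_expr. rewrite Hzo2, (cderiv_unique _ _ _ Hfd), Hzo by exact Hz.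
  field. now apply Hne.
Qed.

(** Serves the closed disk of the product as well as the open disk of the Koebe function. The
    formulas hold on the whole unit disk, which leaves room around each point of [S] for analyticity
    past its boundary. *)
Lemma in_M_on_of_inverse (S : C -> Prop) (f u u1 u2 : C -> C) :
  (forall z, S z -> Cmod z < 1) ->
  (forall z, Cmod z < 1 -> cderiv u z (u1 z)) ->
  (forall z, Cmod z < 1 -> cderiv u1 z (u2 z)) ->
  u 0 = 1 -> (forall z, Cmod z < 1 -> u z <> 0) ->
  (forall z, Cmod z < 1 -> f z = z / u z)%C ->
  (forall z, S z -> Cmod (z ^ 2 * u2 z - z * u1 z + u z - 1) <= 1) ->
  in_M_on S f.
Proof.
  intros HS Hu Hu1 Hu0 Hne Hf HM.
  pose proof (M_expr_of_inverse f u u1 u2 Hu Hu1 Hu0 Hne Hf) as HE.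
  assert (H0 : Cmod 0 < 1) by (rewrite Cmod_0; lra).
  repeat split.
  - intros z Hz. apply locally_Cmod. exists (1 - Cmod z). specialize (HS z Hz).
    split; [lra|]. intros w Hw. apply ball_in_disk in Hw.
    apply cderiv_ex. eexists. now apply HE.
  - rewrite Hf by exact H0. rewrite Hu0. field.
  - apply cderiv_unique. eapply cderiv_eq; [now apply HE|]. rewrite Hu0. field.
  - intros z Hz Hz0 E. specialize (HS z Hz). rewrite Hf in E by exact HS. apply Hz0.
    replace z with (z / u z * u z)%C by (field; now apply Hne). rewrite E. ring.
  - intros z Hz. destruct (HE z (HS z Hz)) as [_ ->]. now apply HM.
Qed.

Lemma cderiv_representation (v : C -> C) (b z : C) :
  holomorphic v -> Cmod z < 1 ->
  cderiv (fun w => 1 + w * (b + v w))%C z (b + v z + z * C_derive v z)%C /\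
  cderiv (fun w => b + v w + w * C_derive v w)%C z
    (2 * C_derive v z + z * C_derive (C_derive v) z)%C.
Proof.
  intros Hv Hz. pose proof (holomorphic_derive v Hv) as Hv1. split.
  - eapply cderiv_eq.
    + apply cderiv_plus; [apply cderiv_const|]. apply cderiv_mult; [apply cderiv_id|].
      apply cderiv_plus; [apply cderiv_const|]. now apply holomorphic_cderiv.
    + cbv beta. ring.
  - eapply cderiv_eq.
    + apply cderiv_plus.
      * apply cderiv_plus; [apply cderiv_const|]. now apply holomorphic_cderiv.
      * apply cderiv_mult; [apply cderiv_id|]. now apply holomorphic_cderiv.
    + cbv beta. ring.
Qed.

(** A factor [z] is divided out twice: [k = f / z] has no zero, as [k 0 = 1], so [u = 1 / k] is
    holomorphic; then [p = (u - 1) / z] is split into its value [b] at 0 and the remainder [v]. *)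
Lemma class_M_representation (f : C -> C) :
  class_M f ->
  holomorphic f /\ exists (b : C) (v : C -> C), holomorphic v /\ v 0 = 0 /\
    forall z, Cmod z < 1 ->
      (1 + z * (b + v z))%C <> 0 /\ f z = (z / (1 + z * (b + v z)))%C /\
      M_expr f z = (z ^ 2 * (C_derive v z + z * C_derive (C_derive v) z))%C.
Proof.
  intros (Ha & Hf0 & Hf1 & Hne & _).
  assert (Hf : holomorphic f).
  { intros z Hz. apply cderiv_ex. exact (locally_singleton _ _ (Ha z Hz)). }
  split; [exact Hf|].
  set (k := diff_quotient f).
  assert (Hfk : forall z, f z = (z * k z)%C).
  { intros z. rewrite (diff_quotient_mult f z), Hf0. fold k. ring. }
  assert (Hk0 : k 0 = 1).
  { unfold k, diff_quotient. destruct (Ceq_dec 0 0) as [_|N]; [exact Hf1|now elim N]. }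
  assert (Hkne : forall z, Cmod z < 1 -> k z <> 0).
  { intros z Hz E. destruct (Ceq_dec z 0) as [->|Hz0].
    - rewrite Hk0 in E. exact (C1_nz E).
    - apply (Hne z Hz Hz0). rewrite Hfk, E. ring. }
  set (u := fun z => (/ k z)%C).
  assert (Hu : holomorphic u).
  { intros z Hz. destruct (holomorphic_diff_quotient f Hf z Hz) as [l Hl].
    eexists. apply cderiv_inv; [now apply Hkne|exact Hl]. }
  set (p := diff_quotient u).
  assert (Hp : holomorphic p) by now apply holomorphic_diff_quotient.
  assert (Hup : forall z, u z = (1 + z * p z)%C).
  { intros z. rewrite (diff_quotient_mult u z). fold p. unfold u at 1. rewrite Hk0.
    f_equal. field. }
  set (v := fun z => (p z - p 0)%C).
  assert (Hv : holomorphic v).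
  { intros z Hz. destruct (Hp z Hz) as [l Hl]. eexists.
    apply cderiv_minus; [exact Hl|apply cderiv_const]. }
  exists (p 0), v. split; [exact Hv|]. split; [unfold v; ring|].
  assert (Huv : forall z, u z = (1 + z * (p 0 + v z))%C).
  { intros z. rewrite Hup. unfold v. ring. }
  intros z Hz. rewrite <- Huv.
  assert (Hune : forall z, Cmod z < 1 -> u z <> 0).
  { intros w Hw E. apply C1_nz. rewrite <- (Cinv_r (k w)) by now apply Hkne.
    change (/ k w)%C with (u w). rewrite E. ring. }
  assert (Hfu : forall z, Cmod z < 1 -> f z = (z / u z)%C).
  { intros w Hw. rewrite Hfk. unfold u. field. now apply Hkne. }
  split; [now apply Hune|]. split; [now apply Hfu|].
  destruct (M_expr_of_inverse f (fun z => 1 + z * (p 0 + v z))%C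
    (fun z => p 0 + v z + z * C_derive v z)%C
    (fun z => 2 * C_derive v z + z * C_derive (C_derive v) z)%C) with (z := z) as [_ ->].
  - intros w Hw. now apply cderiv_representation.
  - intros w Hw. now apply cderiv_representation.
  - rewrite <- (Huv 0). unfold u. rewrite Hk0. field.
  - intros w Hw. rewrite <- Huv. now apply Hune.
  - intros w Hw. rewrite <- Huv. now apply Hfu.
  - exact Hz.
  - ring.
Qed.

(* Schwarz's lemma without dividing out zeros: apply the maximum principle to [G] on
   [|w| = rho], where it is bounded by [/ rho ^ 2]. *)
Lemma schwarz_order_two (G : C -> C) :
  holomorphic G -> (forall z, Cmod z < 1 -> Cmod (z ^ 2 * G z) <= 1) ->
  forall z, Cmod z < 1 -> Cmod (G z) <= 1.
Proof.
  intros HG Hb z Hz. apply Rnot_lt_le. intros Hm.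
  set (m := Cmod (G z)) in *. pose proof (Cmod_ge_0 z) as Hz0.
  assert (Him : 0 < / m < 1).
  { split; [apply Rinv_0_lt_compat; lra|]. rewrite <- Rinv_1. apply Rinv_lt_contravar; lra. }
  (* The circle has to enclose [z] and to satisfy [rho^2 > / m]; the second holds because the
     arithmetic mean of 1 and [/ m] exceeds their geometric mean. *)
  set (rho := Rmax ((1 + Cmod z) / 2) ((1 + / m) / 2)).
  assert (Hr1 : (1 + Cmod z) / 2 <= rho) by apply Rmax_l.
  assert (Hr2 : (1 + / m) / 2 <= rho) by apply Rmax_r.
  assert (Hr3 : rho < 1) by (apply Rmax_lub_lt; lra).
  assert (Hr4 : / m < rho * rho) by nra.
  assert (H : m <= / (rho * rho)).
  { apply (maximum_modulus G rho); [exact HG|lra|lra| |].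
    - left. apply Rinv_0_lt_compat. nra.
    - intros w Hw. specialize (Hb w ltac:(lra)).
      rewrite Cmod_mult, Cmod_pow, Hw in Hb.
      apply Rmult_le_reg_l with (rho * rho); [nra|]. rewrite Rinv_r by nra. simpl in Hb. lra. }
  assert (H2 : / (rho * rho) < / / m) by (apply Rinv_lt_contravar; [nra|exact Hr4]).
  rewrite Rinv_inv in H2. lra.
Qed.

Lemma mean_value_from_0 (G G1 : C -> C) (z : C) :
  (forall w, Cmod w < 1 -> cderiv G w (G1 w)) ->
  (forall w, Cmod w < 1 -> Cmod (G1 w) <= 1) -> G 0 = 0 -> Cmod z < 1 ->
  Cmod (G z) <= Cmod z.
Proof.
  intros HG HG1 H0 Hz.
  replace (G z) with (G z - G 0)%C by (rewrite H0; ring).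
  replace (Cmod z) with (1 * Cmod (z - 0)) by (rewrite Rmult_1_l; f_equal; ring).
  apply cderiv_mean_value. intros t Ht.
  assert (Hin : Cmod (0 + t * (z - 0)) < 1).
  { replace (0 + t * (z - 0))%C with (t * z)%C by ring.
    rewrite Cmod_mult, Cmod_R, Rabs_pos_eq by lra. pose proof (Cmod_ge_0 z). nra. }
  exists (G1 (0 + t * (z - 0))%C). split; [now apply HG|now apply HG1].
Qed.

Lemma class_M_remainder_bounds (v : C -> C) :
  holomorphic v -> v 0 = 0 ->
  (forall z, Cmod z < 1 ->
    Cmod (z ^ 2 * (C_derive v z + z * C_derive (C_derive v) z)) <= 1) ->
  forall z, Cmod z < 1 ->
    Cmod (v z) <= Cmod z /\ Cmod (C_derive v z) <= 1 /\
    Cmod (C_derive v z + z * C_derive (C_derive v) z) <= 1.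
Proof.
  intros Hv Hv0 Hb.
  pose proof (holomorphic_derive v Hv) as Hv1. pose proof (holomorphic_derive _ Hv1) as Hv2.
  assert (HG : forall z, Cmod z < 1 ->
    Cmod (C_derive v z + z * C_derive (C_derive v) z) <= 1).
  { apply (schwarz_order_two (fun z => C_derive v z + z * C_derive (C_derive v) z)%C); [|exact Hb].
    intros z Hz. destruct (Hv1 z Hz) as [l1 H1]. destruct (Hv2 z Hz) as [l2 H2].
    eexists. apply cderiv_plus; [exact H1|]. apply cderiv_mult; [apply cderiv_id|exact H2]. }
  assert (H1 : forall z, Cmod z < 1 -> Cmod (C_derive v z) <= 1).
  (* The bound on [z v'] can be divided by [|z|] only off 0; at 0 the expression bounded by [HG] is
     [v' 0] itself. *)
  { intros z Hz. destruct (Ceq_dec z 0) as [->|Hz0].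
    - specialize (HG 0 Hz).
      replace (C_derive v 0) with (C_derive v 0 + 0 * C_derive (C_derive v) 0)%C by ring.
      exact HG.
    - assert (H : Cmod (z * C_derive v z) <= Cmod z).
      { apply (mean_value_from_0 (fun w => w * C_derive v w)%C
          (fun w => C_derive v w + w * C_derive (C_derive v) w)%C); [|exact HG|ring|exact Hz].
        intros w Hw. eapply cderiv_eq.
        - apply cderiv_mult; [apply cderiv_id|]. now apply holomorphic_cderiv.
        - cbv beta. ring. }
      rewrite Cmod_mult in H. apply Cmod_gt_0 in Hz0.
      apply Rmult_le_reg_l with (Cmod z); lra. }
  intros z Hz. repeat split; [|now apply H1|now apply HG].
  apply (mean_value_from_0 v (C_derive v)); [|exact H1|exact Hv0|exact Hz].
  intros w Hw. now apply holomorphic_cderiv.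
Qed.

(** * The bound for the first coefficient [b] *)

Lemma Cmod_sqr (z : C) : Cmod z ^ 2 = Re z ^ 2 + Im z ^ 2.
Proof. unfold Cmod. rewrite pow2_sqrt; [reflexivity|]. nra. Qed.

(** On squaring, the mixed terms agree and the difference of the two sides is
    [(1 - kappa^2) (kappa^2 |a|^2 - |s|^2)]. Geometrically, [a / (a + s)] lies in the disk bounded
    by a circle of Apollonius, with centre [1 / (1 - kappa^2)] when [kappa < 1]. *)
Lemma apollonius (a s : C) (kappa : R) :
  0 <= kappa <= 1 -> Cmod s <= kappa * Cmod a ->
  Cmod ((kappa * kappa)%R * a + s) <= kappa * Cmod (a + s).
Proof.
  intros Hk Hs. apply Rsqr_incr_0_var; [|apply Rmult_le_pos; [lra|apply Cmod_ge_0]].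
  rewrite !Rsqr_pow2, Rpow_mult_distr, !Cmod_sqr.
  assert (H : Cmod s ^ 2 <= kappa ^ 2 * Cmod a ^ 2).
  { rewrite <- Rpow_mult_distr. apply pow_incr. split; [apply Cmod_ge_0|exact Hs]. }
  rewrite !Cmod_sqr in H. destruct a as [a1 a2], s as [s1 s2].
  unfold Re, Im in *. simpl fst in *. simpl snd in *.
  assert (H1 : 0 <= 1 - kappa ^ 2) by nra.
  pose proof (Rmult_le_compat_r _ _ _ H1 H) as H2.
  simpl. nra.
Qed.

(* If [2 < |b|], the denominator [1 + b z + z v z] would have a zero by Rouche's theorem.
   Instead, [b f] maps a circle [|z| = rho] into a disk [|w - c| <= kappa c], [kappa < 1],
   which does not contain [b f 0 = 0]. *)
Lemma class_M_coefficient_bound (f v : C -> C) (b : C) :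
  holomorphic f -> (forall z, Cmod z < 1 -> Cmod (v z) <= Cmod z) ->
  (forall z, Cmod z < 1 -> (1 + z * (b + v z))%C <> 0) ->
  (forall z, Cmod z < 1 -> f z = (z / (1 + z * (b + v z)))%C) ->
  Cmod b <= 2.
Proof.
  intros Hf Hv Hne Hfz. apply Rnot_lt_le. intros Hb.
  set (beta := Cmod b) in *.
  (* The radius [rho = 1 - s] must satisfy [1 + rho^2 < beta rho]. Since [beta >= 2 + s], this
     follows from [(2 + s) (1 - s) - 1 - (1 - s)^2 = s (1 - 2 s) > 0]. *)
  set (s := Rmin (1 / 4) (beta - 2)).
  assert (Hs : 0 < s /\ s <= 1 / 4 /\ s <= beta - 2).
  { unfold s. repeat split; [apply Rmin_glb_lt; lra|apply Rmin_l|apply Rmin_r]. }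
  set (rho := 1 - s).
  assert (Hrho : 0 < rho < 1) by (unfold rho; lra).
  assert (Hk : 1 + rho ^ 2 < beta * rho).
  { unfold rho. apply Rlt_le_trans with ((2 + s) * (1 - s)); [nra|apply Rmult_le_compat_r; lra]. }
  set (kappa := (1 + rho ^ 2) / (beta * rho)).
  assert (Hbr : 0 < beta * rho) by nra.
  assert (Ek : kappa * (beta * rho) = 1 + rho ^ 2) by (unfold kappa; field; lra).
  assert (Hkap : 0 < kappa < 1).
  { split; [apply Rdiv_lt_0_compat; nra|]. apply Rmult_lt_reg_r with (beta * rho); lra. }
  assert (H0 : Cmod 0 < 1) by (rewrite Cmod_0; lra).
  (* Rescaling that turns the Apollonius disk for [b f] into the disk of radius [kappa] about 0. At
     the origin [f] vanishes, so [H 0 = -1], against [kappa < 1]. *)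
  set (H := fun z => ((1 - kappa * kappa)%R * (b * f z) - 1)%C).
  assert (HH : Cmod (H 0) <= kappa).
  { apply (maximum_modulus H rho); [|exact Hrho|rewrite Cmod_0; lra|lra|].
    - intros z Hz. destruct (Hf z Hz) as [l Hl]. eexists.
      apply cderiv_minus; [|apply cderiv_const].
      apply cderiv_mult; [apply cderiv_const|]. apply cderiv_mult; [apply cderiv_const|exact Hl].
    - intros z Hzr. assert (Hz : Cmod z < 1) by lra.
      specialize (Hv z Hz). specialize (Hne z Hz).
      assert (Hsz : Cmod (1 + z * v z) <= kappa * Cmod (b * z)).
      { rewrite Cmod_mult, Hzr. fold beta. rewrite Ek.
        eapply Rle_trans; [apply Cmod_triangle|]. rewrite Cmod_1, Cmod_mult, Hzr in *.
        pose proof (Cmod_ge_0 (v z)). nra. }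
      pose proof (apollonius (b * z) (1 + z * v z) kappa ltac:(lra) Hsz) as HA.
      assert (Eu : (b * z + (1 + z * v z) = 1 + z * (b + v z))%C) by ring.
      rewrite Eu in HA. unfold H. rewrite Hfz by exact Hz.
      replace ((1 - kappa * kappa)%R * (b * (z / (1 + z * (b + v z)))) - 1)%C
        with (- (((kappa * kappa)%R * (b * z) + (1 + z * v z)) / (1 + z * (b + v z))))%C.
      2: { rewrite RtoC_minus. field. exact Hne. }
      rewrite Cmod_opp, Cmod_div by exact Hne. pose proof (proj1 (Cmod_gt_0 _) Hne).
      apply Rmult_le_reg_r with (Cmod (1 + z * (b + v z))); [assumption|].
      unfold Rdiv. rewrite Rmult_assoc, Rinv_l by lra. lra. }
  unfold H in HH. rewrite Hfz in HH by exact H0.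
  replace (_ - _)%C with (- (1))%C in HH.
  - rewrite Cmod_opp, Cmod_1 in HH. lra.
  - field.
Qed.

(** * Products and sharpness *)

Definition threshold_poly (r : R) : R := 9 * r ^ 4 + 16 * r ^ 3 + 6 * r ^ 2 - 1.

(** Makes the positive root unique, hence smallest, and pushes the extremal value above 1 beyond
    it. *)
Lemma threshold_poly_increasing (r s : R) :
  0 <= r -> r < s -> threshold_poly r < threshold_poly s.
Proof.
  intros Hr Hrs. unfold threshold_poly.
  assert (H2 : r ^ 2 < s ^ 2) by nra.
  assert (H3 : r ^ 3 < s ^ 3) by (simpl in *; nra).
  assert (H4 : r ^ 4 < s ^ 4) by (simpl in *; nra).
  lra.
Qed.

(** The interval has centre 0.294876 and radius [5 / 10 ^ 7], so the sign change yields the root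
    together with its six decimals. *)
Lemma threshold_root :
  exists r0, 2948755 / 10 ^ 7 <= r0 <= 2948765 / 10 ^ 7 /\ threshold_poly r0 = 0.
Proof.
  destruct (IVT threshold_poly (2948755 / 10 ^ 7) (2948765 / 10 ^ 7)) as (r0 & Hr & E).
  - unfold threshold_poly. intros x. reg.
  - lra.
  - unfold threshold_poly. lra.
  - unfold threshold_poly. lra.
  - now exists r0.
Qed.

Lemma Cmod_plus_le (x y : C) (X Y : R) :
  Cmod x <= X -> Cmod y <= Y -> Cmod (x + y) <= X + Y.
Proof. intros Hx Hy. pose proof (Cmod_triangle x y). lra. Qed.

Lemma Cmod_mult_le (x y : C) (X Y : R) :
  Cmod x <= X -> Cmod y <= Y -> Cmod (x * y) <= X * Y.
Proof. intros Hx Hy. rewrite Cmod_mult. apply Rmult_le_compat; auto using Cmod_ge_0. Qed.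

Lemma Cmod_2_le : Cmod 2 <= 2.
Proof. rewrite Cmod_R, Rabs_pos_eq; lra. Qed.

(** The terms are regrouped so that [v2] and [x2] occur only inside the bounded combinations [w] and
    [y]; the linear terms in [b] and [c] have cancelled. After the factor [z^2] the bounds are
    [4 + 2] for [b c + (w + y)], [2 (3 r + r)] for each of the two terms with one coefficient, and
    [8 r^2 + r^2] for the rest. *)
Lemma product_M_expr_bound (z b c v v1 v2 x x1 x2 : C) (r : R) :
  Cmod z <= r -> Cmod b <= 2 -> Cmod c <= 2 ->
  Cmod v <= r -> Cmod v1 <= 1 -> Cmod (v1 + z * v2) <= 1 ->
  Cmod x <= r -> Cmod x1 <= 1 -> Cmod (x1 + z * x2) <= 1 ->
  let u := (1 + z * (b + v))%C in let u1 := (b + v + z * v1)%C in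
  let u2 := (2 * v1 + z * v2)%C in
  let y := (1 + z * (c + x))%C in let y1 := (c + x + z * x1)%C in
  let y2 := (2 * x1 + z * x2)%C in
  Cmod (z ^ 2 * (u2 * y + 2 * (u1 * y1) + u * y2) - z * (u1 * y + u * y1) + u * y - 1)
    <= threshold_poly r + 1.
Proof.
  intros Hz Hb Hc Hv Hv1 Hw Hx Hx1 Hy. cbv zeta.
  set (w := (v1 + z * v2)%C) in *. set (y := (x1 + z * x2)%C) in *.
  replace (_ - 1)%C with
    (z * z * (b * c + (w + y)
      + (b * (z * (y + 2 * x1) + x) + c * (z * (w + 2 * v1) + v))
      + z * (v * y + x * w + 2 * (v * x1) + 2 * (z * (v1 * x1)) + 2 * (x * v1)) + v * x))%C
    by (unfold w, y; ring).
  eapply Rle_trans.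
  - pose proof Cmod_2_le.
    (* The upper bound is still an unknown here; it is assembled along the syntax of the expression
       and compared with the polynomial afterwards. *)
    repeat (eassumption || apply Cmod_plus_le || apply Cmod_mult_le).
  - unfold threshold_poly. right. ring.
Qed.

(** Under [f |-> z / f] the normalised product becomes the ordinary product [u * y], to which
    Leibniz's rule applies. *)
Lemma prod_over_z_of_inverses (g h u y : C -> C) (z : C) :
  (g z = z / u z)%C -> (h z = z / y z)%C -> u z <> 0 -> y z <> 0 ->
  prod_over_z g h z = (z / (u z * y z))%C.
Proof.
  intros Hg Hh Hu Hy. unfold prod_over_z. destruct (Ceq_dec z 0) as [->|Hz].
  - field. now split.
  - rewrite Hg, Hh. field. repeat split; assumption.
Qed.

Lemma cderiv_product_twice (u u1 u2 y y1 y2 : C -> C) (z : C) :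
  cderiv u z (u1 z) -> cderiv u1 z (u2 z) -> cderiv y z (y1 z) -> cderiv y1 z (y2 z) ->
  cderiv (fun w => u w * y w)%C z (u1 z * y z + u z * y1 z)%C /\
  cderiv (fun w => u1 w * y w + u w * y1 w)%C z
    (u2 z * y z + 2 * (u1 z * y1 z) + u z * y2 z)%C.
Proof.
  intros Hu Hu1 Hy Hy1. split; [now apply cderiv_mult|].
  eapply cderiv_eq.
  - apply cderiv_plus; apply cderiv_mult; eassumption.
  - ring.
Qed.

Lemma class_M_estimates (f : C -> C) :
  class_M f -> exists (b : C) (v : C -> C), Cmod b <= 2 /\ holomorphic v /\
    forall z, Cmod z < 1 ->
      (1 + z * (b + v z))%C <> 0 /\ f z = (z / (1 + z * (b + v z)))%C /\
      Cmod (v z) <= Cmod z /\ Cmod (C_derive v z) <= 1 /\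
      Cmod (C_derive v z + z * C_derive (C_derive v) z) <= 1.
Proof.
  intros Hf. destruct (class_M_representation f Hf) as (Hh & b & v & Hv & Hv0 & H).
  pose proof Hf as (_ & _ & _ & _ & HM).
  assert (HB := class_M_remainder_bounds v Hv Hv0).
  lapply HB; [clear HB; intros HB|].
  - exists b, v. split; [|split; [exact Hv|]].
    + apply (class_M_coefficient_bound f v b Hh); intros z Hz; [apply HB|apply H|apply H]; exact Hz.
    + intros z Hz. destruct (H z Hz) as (H1 & H2 & _). split; [exact H1|]. split; [exact H2|].
      now apply HB.
  - intros z Hz. destruct (H z Hz) as (_ & _ & <-). now apply HM.
Qed.

Lemma product_in_M (g h : C -> C) (r0 : R) :
  class_M g -> class_M h -> 0 < r0 < 1 -> threshold_poly r0 = 0 ->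
  in_M_on (closed_disk r0) (prod_over_z g h).
Proof.
  intros Hg Hh Hr Hr0.
  destruct (class_M_estimates g Hg) as (b & v & Hb & Hv & HG).
  destruct (class_M_estimates h Hh) as (c & x & Hc & Hx & HH).
  set (u := fun z => (1 + z * (b + v z))%C). set (y := fun z => (1 + z * (c + x z))%C).
  set (u1 := fun z => (b + v z + z * C_derive v z)%C).
  set (y1 := fun z => (c + x z + z * C_derive x z)%C).
  set (u2 := fun z => (2 * C_derive v z + z * C_derive (C_derive v) z)%C).
  set (y2 := fun z => (2 * C_derive x z + z * C_derive (C_derive x) z)%C).
  assert (Hd : forall z, Cmod z < 1 ->
    cderiv (fun w => u w * y w)%C z (u1 z * y z + u z * y1 z)%C /\
    cderiv (fun w => u1 w * y w + u w * y1 w)%C z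
      (u2 z * y z + 2 * (u1 z * y1 z) + u z * y2 z)%C).
  { intros z Hz. destruct (cderiv_representation v b z Hv Hz).
    destruct (cderiv_representation x c z Hx Hz). now apply cderiv_product_twice. }
  apply (in_M_on_of_inverse _ _ (fun z => u z * y z)%C (fun z => u1 z * y z + u z * y1 z)%C
    (fun z => u2 z * y z + 2 * (u1 z * y1 z) + u z * y2 z)%C).
  - unfold closed_disk. intros z Hz. lra.
  - intros z Hz. now apply Hd.
  - intros z Hz. now apply Hd.
  - unfold u, y. ring.
  - intros z Hz. apply Cmult_neq_0; [now apply HG|now apply HH].
  - intros z Hz. apply (prod_over_z_of_inverses g h u y); now (apply HG || apply HH).
  - unfold closed_disk. intros z Hz. assert (Hz1 : Cmod z < 1) by lra.
    destruct (HG z Hz1) as (_ & _ & G1 & G2 & G3). destruct (HH z Hz1) as (_ & _ & H1 & H2 & H3).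
    (* The estimate at radius [r0] is exactly 1, because [r0] is the root. *)
    apply Rle_trans with (threshold_poly r0 + 1); [|lra].
    apply product_M_expr_bound; assumption || lra.
Qed.

(** Extremal in every estimate at once: [b = 2], [v z = z], [v' = 1], [v'' = 0]. At a positive point
    all terms of the product expression are positive, so no triangle inequality loses anything. *)
Definition koebe (z : C) : C := (z / (1 + z) ^ 2)%C.

Lemma cderiv_koebe_denominator (z : C) :
  cderiv (fun w => (1 + w) ^ 2)%C z (2 * (1 + z))%C /\
  cderiv (fun w => 2 * (1 + w))%C z (RtoC 2).
Proof.
  assert (H : cderiv (fun w => 1 + w)%C z (0 + 1)%C).
  { apply cderiv_plus; [apply cderiv_const|apply cderiv_id]. }
  split.
  - apply (cderiv_ext_ball (fun w => (1 + w) * (1 + w))%C _ z _ 1); [lra|intros; ring|].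
    eapply cderiv_eq; [apply cderiv_mult; exact H|]. ring.
  - eapply cderiv_eq; [apply cderiv_mult; [apply cderiv_const|exact H]|]. cbv beta. ring.
Qed.

Lemma koebe_denominator_neq (z : C) : Cmod z < 1 -> ((1 + z) ^ 2)%C <> 0.
Proof.
  intros Hz. apply Cpow_nz, Cmod_pos_neq.
  pose proof (Cmod_reverse 1 z) as H. rewrite Cmod_1 in H. lra.
Qed.

Lemma koebe_class_M : class_M koebe.
Proof.
  apply (in_M_on_of_inverse _ _ (fun w => (1 + w) ^ 2)%C (fun w => 2 * (1 + w))%C (fun _ => RtoC 2)).
  - intros z Hz. exact Hz.
  - intros z _. apply cderiv_koebe_denominator.
  - intros z _. apply cderiv_koebe_denominator.
  - ring.
  - apply koebe_denominator_neq.
  - reflexivity.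
  - unfold unit_disk. intros z Hz.
    replace (_ - 1)%C with (z ^ 2)%C by ring.
    rewrite Cmod_pow. pose proof (Cmod_ge_0 z). simpl. nra.
Qed.

Lemma koebe_product_M_expr (r : R) :
  0 < r < 1 -> M_expr (prod_over_z koebe koebe) r = RtoC (threshold_poly r + 1).
Proof.
  intros Hr.
  set (u := fun w => ((1 + w) ^ 2)%C). set (u1 := fun w : C => (2 * (1 + w))%C).
  assert (Hd : forall z,
    cderiv (fun w => u w * u w)%C z (u1 z * u z + u z * u1 z)%C /\
    cderiv (fun w => u1 w * u w + u w * u1 w)%C z (2 * u z + 2 * (u1 z * u1 z) + u z * 2)%C).
  { intros z. destruct (cderiv_koebe_denominator z).
    now apply (cderiv_product_twice u u1 (fun _ => RtoC 2) u u1 (fun _ => RtoC 2)). }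
  destruct (M_expr_of_inverse (prod_over_z koebe koebe) (fun w => u w * u w)%C
    (fun z => u1 z * u z + u z * u1 z)%C
    (fun z => 2 * u z + 2 * (u1 z * u1 z) + u z * 2)%C) with (z := RtoC r) as [_ ->].
  - intros z _. apply Hd.
  - intros z _. apply Hd.
  - unfold u. ring.
  - intros z Hz. apply Cmult_neq_0; now apply koebe_denominator_neq.
  - intros z Hz. apply (prod_over_z_of_inverses koebe koebe u u); try reflexivity;
      now apply koebe_denominator_neq.
  - rewrite Cmod_R, Rabs_pos_eq; lra.
  - unfold u, u1, threshold_poly.
    rewrite !RtoC_plus, RtoC_minus, !RtoC_plus, !RtoC_mult, !RtoC_pow. ring.
Qed.

Theorem theorem4p1 :
  exists r0 : R,
    smallest_root_in_01 r0 /\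
    Rabs (r0 - 294876 / 10 ^ 6) <= 5 / 10 ^ 7 /\
    (forall g h : C -> C, class_M g -> class_M h ->
       in_M_on (closed_disk r0) (prod_over_z g h)) /\
    (forall r : R, r0 < r < 1 ->
       exists g h : C -> C, class_M g /\ class_M h /\
         ~ in_M_on (closed_disk r) (prod_over_z g h)).
Proof.
  destruct threshold_root as (r0 & Hr & E).
  exists r0. split; [split; [split; [lra|exact E]|]|split; [apply Rabs_le; lra|split]].
  - intros s [Hs Es]. apply Rnot_lt_le. intros Hlt.
    pose proof (threshold_poly_increasing s r0 ltac:(lra) Hlt) as H.
    fold (threshold_poly s) in Es. lra.
  - intros g h Hg Hh. apply product_in_M; [exact Hg|exact Hh|lra|exact E].
  - intros r Hr1. exists koebe, koebe.
    split; [apply koebe_class_M|]. split; [apply koebe_class_M|].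
    intros (_ & _ & _ & _ & HM).
    assert (Hcr : Cmod r = r) by (rewrite Cmod_R; apply Rabs_pos_eq; lra).
    specialize (HM r ltac:(unfold closed_disk; lra)).
    rewrite koebe_product_M_expr, Cmod_R in HM by lra.
    pose proof (threshold_poly_increasing r0 r ltac:(lra) ltac:(lra)) as H.
    pose proof (Rle_abs (threshold_poly r + 1)). lra.
Qed.
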